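(* Let $\sigma,\mu>0$, $\kappa\ge 0$ be constants. Let $T>0$, $\varphi_0\in\bar S$, $\bar\varphi_0\in S$, $(\xi_0,w_0)\in\mathbb{R}^2$, $f\in L^2(0,T)$ be given. Let $\xi,w:[0,T]\to\mathbb{R}$, $\varphi\in L^2((0,T);H^3(0,1)\cap\bar S)$ be a weak solution on $[0,T]$ (in the sense defined in the context) of the initial-boundary value problem (P) with initial condition $\varphi[0]=\varphi_0$, $\varphi_t[0]=\bar\varphi_0$, $(\xi(0),w(0))=(\xi_0,w_0)$. Suppose that $$\varphi\in C^0([0,T];\bar S\cap H^4(0,1))\cap C^1([0,T];\bar S)\cap C^2([0,T];L^2(0,1)).$$ Then (after possibly modifying $f$ on a set of measure zero) all the equations of (P) hold for all $t\in[0,T]$, i.e., for all $t\in[0,T]$: $$\dot\xi(t)=w(t),\qquad \dot w(t)=-f(t),$$ $$\varphi_{tt}[t]=\varphi_{xx}[t]-\sigma\varphi_{xxxx}[t]+\mu\varphi_{txx}[t]-\kappa\varphi_t[t]\quad\text{(as an equality in }L^2(0,1)),$$ $$\varphi_x(t,0)=\varphi_x(t,1)=0,\qquad \varphi_{xxx}(t,0)=\varphi_{xxx}(t,1)=-\sigma^{-1}f(t),$$ $$\int_0^1\varphi(t,x)\,dx=\int_0^1\varphi_t(t,x)\,dx=0.$$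
   Context: Notation: $\varphi[t]$ denotes the profile $x\mapsto\varphi(t,x)$; $H^k(0,1)=W^{k,2}(0,1)$; $H^1_0(0,1)$ is the closure of $C^1_c((0,1))$ in $H^1(0,1)$; $\chi_{[0,1]}$ is the characteristic function of $[0,1]$ (i.e. the constant function $1$ on $[0,1]$). Elements of $L^p$ spaces are equivalence classes of a.e.-equal measurable functions. Spaces of the form $C^j([0,T];X)$ use the norm of $X$: the $H^2$ norm for $\bar S$, the $H^4$ norm for $\bar S\cap H^4(0,1)$. Spaces: $\bar S=\{\varphi\in H^2(0,1):\varphi'(0)=\varphi'(1)=\int_0^1\varphi(x)dx=0\}$ and $S=\{\varphi\in L^2(0,1):\int_0^1\varphi(x)dx=0\}$. Problem (P) is the PDE-ODE system, for $t\ge0$, $x\in(0,1)$, with input $f$: $\dot\xi=w$, $\dot w=-f$; $\varphi_{tt}=\varphi_{xx}-\sigma\varphi_{xxxx}+\mu\varphi_{txx}-\kappa\varphi_t$; $\varphi_x(t,0)=\varphi_x(t,1)=0$; $\varphi_{xxx}(t,0)=\varphi_{xxx}(t,1)=-\sigma^{-1}f(t)$; $\int_0^1\varphi(t,x)dx=\int_0^1\varphi_t(t,x)dx=0$. Weak solution on $[0,T]$: given $\varphi_0\in\bar S$, $\bar\varphi_0\in S$, $(\xi_0,w_0)\in\mathbb{R}^2$, $f\in L^2(0,T)$, absolutely continuous functions $\xi,w:[0,T]\to\mathbb{R}$ and a function $\varphi:[0,T]\to\bar S$ (absolutely continuous as a map into $L^2(0,1)$) constitute a weak solution on $[0,T]$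 of (P) with initial condition $\varphi[0]=\varphi_0$, $\varphi_t[0]=\bar\varphi_0$, $(\xi(0),w(0))=(\xi_0,w_0)$, if: $\dot\xi=w$, $\dot w=-f$ hold for a.e. $t\in(0,T)$; $\varphi\in L^2((0,T);H^3(0,1)\cap\bar S)$; the initial condition holds; and there exists $u\in C^0([0,T];H_0^1(0,1))\cap L^2((0,T);H^2(0,1))$ with $u_t\in L^2((0,T);L^2(0,1))$ such that (i) $\varphi_t[t]=u_x[t]$ for $t\in[0,T]$; (ii) $u_t[t]=\varphi_x[t]-\sigma\varphi_{xxx}[t]+\mu u_{xx}[t]-\kappa u[t]-f(t)\chi_{[0,1]}$ for a.e. $t\in(0,T)$. *)

(* Defs.v *)
From HB Require Import structures.
From mathcomp Require Import all_boot all_order all_algebra.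
From mathcomp Require Import all_classical all_reals all_analysis.
Set Implicit Arguments.
Unset Strict Implicit.
Unset Printing Implicit Defensive.
Import Order.TTheory GRing.Theory Num.Theory.
Import numFieldNormedType.Exports.
Local Open Scope classical_set_scope.
Local Open Scope ring_scope.

(* Elements of L^2(0,1) are represented by functions R -> R, of which only the
   a.e. class on ]0,1[ matters; equality of two elements is [eqI].  A function
   of time with values in such a space is a map t |-> F t : R -> R, of which
   only the values at t in [0,T] matter. *)

(* A normed space given inside an ambient vector space V: the norm is only
   meaningful on the carrier, so every use comes with membership. *)
Record nspace (R : realType) (V : Type) := NSpace {
  carrier :> V -> Prop ;
  nrm : V -> R }.

Section Sobolev.
Context {R : realType}.
Implicit Types (a b x : R) (f g h p : R -> R) (k : nat).

Definition aeOn (D : set R) (P : R -> Prop) : Prop :=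
  {ae (@lebesgue_measure R), forall x, D x -> P x}.

Definition eqI f g : Prop := aeOn `]0, 1[ (fun x => f x = g x).

Definition L2on (D : set R) : set (R -> R) :=
  [set f | f \_ D \in Lfun (@lebesgue_measure R) 2%:E].

Definition L2norm f : R :=
  fine 'N[@lebesgue_measure R]_2%:E[EFin \o (f \_ `]0, 1[)].

Definition intI f : R := (\int[@lebesgue_measure R]_(x in `]0, 1[) f x)%R.

(* C^1_c((a,b)), each function being extended by 0 to R. *)
Definition C1c a b : set (R -> R) :=
  [set p : R -> R | [/\ forall x, derivable p x 1, continuous (derive1 p) &
    exists c d, [/\ a < c, d < b & forall x, ~ (c <= x <= d) -> p x = 0]]].

(* g is a weak derivative of f on (0,1). *)
Definition is_wderiv f g : Prop :=
  forall p, C1c 0 1 p ->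
    intI (fun x => f x * derive1 p x) = - intI (fun x => g x * p x).

(* The weak derivative, as a representative that depends only on the a.e. class
   of f; the junk value 0 is returned if f has no weak derivative in L^2. *)
Definition wderiv f : R -> R :=
  xget (fun=> 0) [set g | L2on `]0, 1[ g /\ is_wderiv f g].

Definition wderivn k f : R -> R := iter k wderiv f.

(* H^k(0,1) = W^{k,2}(0,1), by f in H^{k+1} iff f in L^2 and f' in H^k *)
Fixpoint inH k : set (R -> R) :=
  if k is k'.+1 then
    [set f | L2on `]0, 1[ f /\ exists2 g, is_wderiv f g & inH k' g]
  else L2on `]0, 1[.

Definition Hnorm k f : R :=
  Num.sqrt (\sum_(j < k.+1) L2norm (wderivn j f) ^+ 2).

(* Pointwise values on [0,1] of an element of H^1(0,1) are those of its
   continuous representative. *)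
Definition crep f : R -> R :=
  xget (fun=> 0) [set h : R -> R | {within `[0 : R, 1 : R], continuous h} /\ eqI f h].

Definition trace f x : R := crep f x.

Definition L2I : nspace R (R -> R) := NSpace (L2on `]0, 1[) L2norm.

Definition Hk k : nspace R (R -> R) := NSpace (inH k) (Hnorm k).

Definition H10 : nspace R (R -> R) :=
  NSpace [set f | inH 1 f /\
    forall e, 0 < e -> exists2 p, C1c 0 1 p & Hnorm 1 (f - p) < e] (Hnorm 1).

Definition Smean0 : nspace R (R -> R) :=
  NSpace [set f | L2on `]0, 1[ f /\ intI f = 0] L2norm.

Definition Sbar : nspace R (R -> R) :=
  NSpace [set f | [/\ inH 2 f, trace (wderiv f) 0 = 0,
                      trace (wderiv f) 1 = 0 & intI f = 0]] (Hnorm 2).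

Definition SbarH k : nspace R (R -> R) := NSpace (carrier Sbar `&` inH k) (Hnorm k).

Definition scalars : nspace R R^o := NSpace setT (fun x : R^o => `|x|).

End Sobolev.

Section VectorValued.
Context {R : realType} {V : lmodType R}.
Implicit Types (T t : R) (X : nspace R V) (F G : R -> V).

(* G0 is the derivative of F at t in [0,T], in the norm of X; one-sided at the
   endpoints. *)
Definition is_tderiv T X F t (G0 : V) : Prop :=
  X G0 /\
  nrm X ((s - t)^-1 *: (F s - F t) - G0) @[s --> within `[0, T] t^'] --> (0 : R).

(* C^j([0,T]; X) *)
Fixpoint Ccls (j : nat) T X F : Prop :=
  (forall t, 0 <= t <= T ->
     X (F t) /\ nrm X (F s - F t) @[s --> within `[0, T] (nbhs t)] --> (0 : R)) /\
  (if j is j'.+1 then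
     exists G, (forall t, 0 <= t <= T -> is_tderiv T X F t (G t)) /\ Ccls j' T X G
   else True).

Definition abs_cont T X F : Prop :=
  forall e : R, 0 < e -> exists2 d : R, 0 < d &
    forall (m : nat) (a b : 'I_m -> R),
      (forall i, [/\ 0 <= a i, a i <= b i & b i <= T]) ->
      trivIset setT (fun i => `]a i, b i[%classic) ->
      \sum_(i < m) (b i - a i) < d ->
      \sum_(i < m) nrm X (F (b i) - F (a i)) < e.

(* The simple function t |-> sum_i 1_{A_i}(t) v_i *)
Record sfun := SFun {
  sf_size : nat ;
  sf_set : 'I_sf_size -> set R ;
  sf_val : 'I_sf_size -> V }.

Definition sf_ok T X (s : sfun) : Prop :=
  forall i : 'I_(sf_size s),
    [/\ measurable (sf_set i), sf_set i `<=` `]0, T[ & X (sf_val i)].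

Definition sf_eval (s : sfun) t : V :=
  \sum_(i < sf_size s) \1_(sf_set i) t *: sf_val i.

Definition sf_int (s : sfun) : V :=
  \sum_(i < sf_size s) fine ((@lebesgue_measure R) (sf_set i)) *: sf_val i.

Definition sf_approx T X F (s : nat -> sfun) : Prop :=
  (forall n, sf_ok T X (s n)) /\
  aeOn `]0, T[ (fun t =>
    X (F t) /\ nrm X (sf_eval (s n) t - F t) @[n --> \oo] --> (0 : R)).

Definition strongly_measurable T X F : Prop := exists s, sf_approx T X F s.

(* F belongs to L^2((0,T); X).  The integral of a nonnegative function is a
   supremum over simple minorants, so it is insensitive to null sets and the
   measurability of t |-> |F t| up to a null set follows from the first
   clause. *)
Definition L2time T X F : Prop :=
  strongly_measurable T X F /\
  (\int[@lebesgue_measure R]_(t in `]0%R, T[) (nrm X (F t) ^+ 2)%:E < +oo)%E.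

(* w is the Bochner integral of F over (0,T), in X. *)
Definition is_bochner T X F (w : V) : Prop :=
  X w /\ exists s, [/\ sf_approx T X F s,
    (\int[@lebesgue_measure R]_(t in `]0%R, T[)
       (nrm X (sf_eval (s n) t - F t))%:E)%E @[n --> \oo] --> (0 : \bar R) &
    nrm X (sf_int (s n) - w) @[n --> \oo] --> (0 : R)].

(* G is the weak (distributional) derivative of F on (0,T), in X. *)
Definition is_weak_tderiv T X F G : Prop :=
  forall p : R -> R, C1c 0 T p ->
    exists w, is_bochner T X (fun t => derive1 p t *: F t) w /\
              is_bochner T X (fun t => p t *: G t) (- w).

End VectorValued.

Section ProblemP.
Context {R : realType}.
Implicit Types (sigma mu kappa T : R) (phi : R -> R -> R).
Implicit Types (f xi w : R -> R).

(* The system is, for x in (0,1),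
     xi' = w,  w' = -f,
     phi_tt = phi_xx - sigma phi_xxxx + mu phi_txx - kappa phi_t,
     phi_x = 0 and phi_xxx = - f / sigma at x = 0 and x = 1,
     int phi = int phi_t = 0.
   In the weak form u is the x-primitive of phi_t, and the condition on phi_xxx
   is carried by u vanishing at x = 0 and x = 1. *)
Definition weak_solution sigma mu kappa T (phi0 phib0 : R -> R) (xi0 w0 : R)
    f xi w phi : Prop :=
  [/\ [/\ abs_cont T scalars xi, abs_cont T scalars w,
          (forall t, 0 <= t <= T -> Sbar (phi t)) & abs_cont T L2I phi],
      [/\ aeOn `]0, T[ (fun t => is_tderiv T scalars xi t (w t)),
          aeOn `]0, T[ (fun t => is_tderiv T scalars w t (- f t)) &
          L2time T (SbarH 3) phi],
      [/\ eqI (phi 0) phi0, is_tderiv T L2I phi 0 phib0, xi 0 = xi0 & w 0 = w0] &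
      exists u ut : R -> R -> R,
        [/\ Ccls 0 T H10 u, L2time T (Hk 2) u,
            is_weak_tderiv T L2I u ut /\ L2time T L2I ut,
            forall t, 0 <= t <= T -> is_tderiv T L2I phi t (wderiv (u t)) &
            aeOn `]0, T[ (fun t => eqI (ut t) (fun x =>
              wderiv (phi t) x - sigma * wderivn 3 (phi t) x
              + mu * wderivn 2 (u t) x - kappa * u t x - f t))]].

Definition equations_hold sigma mu kappa T f xi w phi : Prop :=
  exists phit phitt : R -> R -> R, forall t, 0 <= t <= T ->
    [/\ is_tderiv T scalars xi t (w t) /\ is_tderiv T scalars w t (- f t),
        [/\ is_tderiv T L2I phi t (phit t), is_tderiv T L2I phit t (phitt t) &
            eqI (phitt t) (fun x =>
              wderivn 2 (phi t) x - sigma * wderivn 4 (phi t) x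
              + mu * wderivn 2 (phit t) x - kappa * phit t x)],
        trace (wderiv (phi t)) 0 = 0 /\ trace (wderiv (phi t)) 1 = 0,
        trace (wderivn 3 (phi t)) 0 = - sigma^-1 * f t /\
        trace (wderivn 3 (phi t)) 1 = - sigma^-1 * f t &
        intI (phi t) = 0 /\ intI (phit t) = 0].

End ProblemP.

(* Main.v *)
Require Import Defs.
From HB Require Import structures.
From mathcomp Require Import all_boot all_order all_algebra.
From mathcomp Require Import all_classical all_reals all_analysis.
From mathcomp Require Import measurable_realfun ring lra.
Import Order.TTheory GRing.Theory Num.Theory.
Import numFieldNormedType.Exports.
Local Open Scope classical_set_scope.
Local Open Scope ring_scope.
Set Implicit Arguments.
Unset Strict Implicit.
Unset Printing Implicit Defensive.

(** The weak formulation lives one space derivative below the equation: [u] is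
    a primitive in [x] of [phi_t], and the evolution equation for [u] becomes
    the equation for [phi] after differentiation in [x].  The proof does not
    differentiate in [x]: it pairs the weak equation with functions of [x] and uses
    that, for a test function [q], the number [<u, q'> = - <phi_t, q>] is
    continuously differentiable in time with derivative [- <phi_tt, q>], because
    [phi] is twice differentiable with values in [L^2].  A Bochner integral
    commutes with the pairing [<., q'>] ([bochner_ip]), so [<u_t, q'>] is the
    distributional derivative of that scalar function, and the fundamental lemma
    of the calculus of variations identifies it with [- <phi_tt, q>] for almost
    every time ([weak_tderiv_ip]).

    Testing the weak equation is then integration by parts in [x]
    ([tested_equation]), and two choices of [q] suffice.
    - For [q] of class C^1 with compact support the force [f] drops out, since
      [q'] has mean zero.  What remains is an equality, for almost every time,
      between two functions of time that are continuous on [[0, T]], hence an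
      equality for every time; as [q] is arbitrary this is the partial
      differential equation in [L^2] ([strong_equation]).  The exceptional null
      set of times may depend on [q], since continuity in time removes it before
      [q] varies.
    - For [q = x] the boundary terms at [x = 1] survive, and subtracting the
      equation already obtained leaves [f = - sigma phi_xxx(., 1)] almost
      everywhere ([boundary_force]).

    The right-hand side of the last identity is continuous in time; it is the
    modified force.  The value of [phi_xxx] at [x = 0] is the same one:
    integrating the equation over [(0, 1)] kills every term except [phi_xxxx],
    because [phi] and [phi_t] satisfy the Neumann condition and [phi_t],
    [phi_tt] have mean zero ([flux_balance]).  Boundary values are handled
    through the formulas [trace0E] and [trace1E], which write the value at an
    end point of an [H^1] function as an integral of the function and of its
    weak derivative; they make traces linear and continuous in time at once.

    For the ordinary differential equations, an absolutely continuous function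
    whose derivative agrees almost everywhere with a continuous function is
    differentiable everywhere with that derivative ([abs_cont_C1]).  The core is
    [abs_cont_slope]: the null set of bad times lies in an open set of small
    measure, which contributes little by absolute continuity, and outside of it
    the increments are controlled by the derivative. *)

(** * Square-integrable functions *)

Section L2.
Context {R : realType}.
Local Notation mu := (@lebesgue_measure R).
Implicit Types (f g h : R -> R) (D : set R).

Lemma aeOnS D (P Q : R -> Prop) : (forall x, D x -> P x -> Q x) ->
  aeOn D P -> aeOn D Q.
Proof.
move=> PQ [N [mN N0 HN]]; exists N; split => //; apply: subset_trans HN.
by apply: subsetC => x /= HP Dx; apply: PQ (HP Dx).
Qed.

Lemma aeOnI D (P Q : R -> Prop) : aeOn D P -> aeOn D Q ->
  aeOn D (fun x => P x /\ Q x).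
Proof.
move=> [N [mN N0 HN]] [N' [mN' N0' HN']]; exists (N `|` N'); split.
- exact: measurableU.
- by rewrite (@measureU0 _ _ _ mu).
- move=> x /= Hx; apply: contrapT => /not_orP[nN nN']; apply: Hx => Dx.
  split; apply: contrapT => H.
    by apply: nN; apply: HN => /(_ Dx).
  by apply: nN'; apply: HN' => /(_ Dx).
Qed.

Lemma L2on_measurable D f : measurable D -> L2on D f -> measurable_fun D f.
Proof.
move=> mD; rewrite /L2on/= inE => /andP[+ _]; rewrite inE/=.
by move/(measurable_restrictT _ mD).
Qed.

Lemma L2onD D f g : L2on D f -> L2on D g -> L2on D (fun x => f x + g x).
Proof.
move=> hf hg; rewrite /L2on/= (_ : _ \_ D = f \_ D + g \_ D).
  by apply: (@Lfun_addr_closed _ _ _ mu 2%:E (lee1n 2)).2; [exact: hf|exact: hg].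
by apply/funext => x; rewrite fctE !patchE; case: ifPn; rewrite ?addr0.
Qed.

Lemma L2onZ D f (c : R) : L2on D f -> L2on D (fun x => c * f x).
Proof.
move=> hf; rewrite /L2on/= (_ : _ \_ D = c \o* (f \_ D)).
  by apply: Lfun_scale => //; rewrite ler1n.
by apply/funext => x; rewrite /= !patchE; case: ifPn => _; rewrite ?mul0r 1?mulrC.
Qed.

Lemma L2onB D f g : L2on D f -> L2on D g -> L2on D (fun x => f x - g x).
Proof.
move=> hf /(L2onZ (-1)) hg.
rewrite (_ : (fun x => _) = (fun x => f x + -1 * g x)); first exact: L2onD.
by apply/funext => x; rewrite mulN1r.
Qed.

Lemma L2on_mul_integrable D f g : measurable D -> L2on D f -> L2on D g ->
  mu.-integrable D (EFin \o (fun x => f x * g x)).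
Proof.
move=> mD hf hg; have /Lfun1_integrable := Lfun2_mul_Lfun1 hf hg.
rewrite (_ : EFin \o _ = (EFin \o (fun x => f x * g x)) \_ D).
  by rewrite -integrable_mkcond.
by apply/funext => x; rewrite /= !patchE; case: ifPn; rewrite ?mul0r.
Qed.

Lemma L2on_bounded D f (M : R) : measurable D -> (mu D < +oo)%E ->
  measurable_fun D f -> (forall x, D x -> `|f x| <= M) -> L2on D f.
Proof.
move=> mD Doo mf fM; rewrite /L2on/= inE; apply/andP; split; rewrite inE/=.
  exact/(measurable_restrictT _ mD).
rewrite /finite_norm unlock; apply: poweR_lty.
have M0 : 0 <= Num.max M 0 by rewrite le_max lexx orbT.
apply: (@le_lt_trans _ _ (\int[mu]_(x in D) (Num.max M 0 ^+ 2)%:E)%E); last first.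
  rewrite integral_cst// lte_mul_pinfty// lee_fin.
  by rewrite exprn_ge0.
rewrite [leRHS]integral_mkcond; apply: ge0_le_integral => //=.
- apply/measurable_EFinP; apply: (measurableT_comp (measurable_powR _)) => //.
  by apply: measurableT_comp => //; exact/(measurable_restrictT _ mD).
- by apply/(measurable_restrictT _ mD); exact: measurable_cst.
- move=> x _; rewrite !patchE; case: ifPn => [|_]; last first.
    by rewrite normr0 powR0 ?lee_fin.
  move/set_mem => Dx; rewrite lee_fin powR_mulrn// lerXn2r ?nnegrE//.
  by rewrite le_max fM.
Qed.

Lemma L2on_integrable D f : measurable D -> (mu D < +oo)%E -> L2on D f ->
  mu.-integrable D (EFin \o f).
Proof.
move=> mD Doo hf; have h1 : L2on D (fun=> 1).
  by apply: (@L2on_bounded _ _ 1) => // x _; rewrite normr1.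
have := L2on_mul_integrable mD hf h1; apply: eq_integrable => // x _ /=.
by rewrite mulr1.
Qed.

(** Stated with the norm of the restriction, which is the form that [L2norm]
    takes on the unit interval. *)
Lemma cauchy_schwarz D f g : measurable D -> L2on D f -> L2on D g ->
  `|\int[mu]_(x in D) (f x * g x)| <=
  fine 'N[mu]_2%:E[EFin \o (f \_ D)] * fine 'N[mu]_2%:E[EFin \o (g \_ D)].
Proof.
move=> mD hf hg; have ifg := L2on_mul_integrable mD hf hg.
move: (hf) (hg); rewrite /L2on/= !inE => /andP[+ +] /andP[].
rewrite !inE/= => mf nf mg ng.
rewrite -lee_fin EFin_normr_Rintegral// EFinM !fineK; last 2 first.
- by rewrite ge0_fin_numE// Lnorm_ge0.
- by rewrite ge0_fin_numE// Lnorm_ge0.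
apply: le_trans (@hoelder _ _ _ mu _ _ 2 2 mf mg _ _ _) => //; last first.
  by rewrite [RHS]splitr !div1r.
apply: le_trans (le_abse_integral _ _ _) _ => //.
  by have /integrableP[] := ifg.
rewrite Lnorm1 integral_mkcond; apply: ge0_le_integral => //=.
- by move=> x _; apply: erestrict_ge0.
- apply/(measurable_restrictT _ mD); do 2! apply: measurableT_comp => //.
  by apply: measurable_funM; exact: L2on_measurable.
- by do 2! apply: measurableT_comp => //; apply: measurable_funM.
- by move=> x _; rewrite !patchE; case: ifPn; rewrite /= ?mul0r ?normr0.
Qed.

Lemma integrable_mul_bounded D f h (M : R) : measurable D ->
  mu.-integrable D (EFin \o f) -> measurable_fun D h ->
  (forall x, D x -> `|h x| <= M) ->
  mu.-integrable D (EFin \o (fun x => f x * h x)).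
Proof.
move=> mD intf mh hM; have hbd : [bounded h x | x in D].
  exists M; split; first exact: num_real.
  by move=> y My x Dx; apply: le_trans (ltW My); exact: hM.
have := @integrableMl _ _ _ mu D mD (EFin \o f) h intf mh hbd.
by apply: eq_integrable => // x _ /=; rewrite EFinM.
Qed.

Lemma integrable_scale D f (k : R) : measurable D -> mu.-integrable D (EFin \o f) ->
  mu.-integrable D (EFin \o (fun x => k * f x)).
Proof.
move=> mD intf; have := @integrableZl _ _ _ mu D mD k (EFin \o f) intf.
by apply: eq_integrable => // x _ /=; rewrite EFinM.
Qed.

Lemma itv_measure_lty (b0 b1 : bool) (a b : R) :
  (mu [set` Interval (BSide b0 a) (BSide b1 b)] < +oo)%E.
Proof.
by rewrite [X in (X < _)%E]lebesgue_measure_itv/=; case: ifP => //; rewrite -EFinB ltry.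
Qed.

Lemma fine_itv_measure (b0 b1 : bool) (a b : R) : a <= b ->
  fine (mu [set` Interval (BSide b0 a) (BSide b1 b)]) = b - a.
Proof.
rewrite le_eqVlt => /predU1P[->|ab]; rewrite [X in fine X]lebesgue_measure_itv/=.
  by rewrite ltxx subrr.
by rewrite lte_fin ab.
Qed.

Lemma bounded_integrable D f (M : R) : measurable D -> (mu D < +oo)%E ->
  measurable_fun D f -> (forall x, D x -> `|f x| <= M) ->
  mu.-integrable D (EFin \o f).
Proof.
move=> mD Doo mf fM; apply: measurable_bounded_integrable => //.
exists M; split; first exact: num_real.
by move=> y My x Dx; apply: le_trans (ltW My); exact: fM.
Qed.

Lemma EFin_Rintegral D f : measurable D -> mu.-integrable D (EFin \o f) ->
  (\int[mu]_(x in D) f x)%:E = (\int[mu]_(x in D) (f x)%:E)%E.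
Proof. by move=> mD intf; rewrite /Rintegral fineK//; exact: integrable_fin_num. Qed.

End L2.

(** * The fundamental lemma of the calculus of variations *)

Section FundamentalLemma.
Context {R : realType}.
Local Notation mu := (@lebesgue_measure R).
Implicit Types (f g : R -> R) (a b c d x : R).

Lemma is_derive_cvg f x l :
  h^-1 *: (f (h + x) - f x) @[h --> 0^'] --> l -> is_derive x 1 f l.
Proof.
move=> fl; have {}fl : h^-1 *: (f (h *: 1 + x) - f x) @[h --> 0^'] --> l.
  by under eq_fun do rewrite [_ *: 1]mulr1.
by split; [apply: (cvgP l)|exact: (cvg_lim _ fl)].
Qed.

Lemma is_derive_ext f g x l l' :
  is_derive x 1 f l -> f =1 g -> l = l' -> is_derive x 1 g l'.
Proof. by move=> fl /funext <- <-. Qed.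

(** The square of the positive part, the simplest C^1 function that is positive
    on a half-line and vanishes on the other. *)
Definition possq x := ((x + `|x|) / 2) ^+ 2.

Lemma possq_gt0 x : 0 < x -> 0 < possq x.
Proof. by move=> x0; rewrite /possq gtr0_norm// exprn_gt0// divr_gt0// addr_gt0. Qed.

Lemma possq_eq0 x : x <= 0 -> possq x = 0.
Proof. by move=> x0; rewrite /possq ler0_norm// subrr mul0r expr0n. Qed.

Lemma possq_ge0 x : 0 <= possq x.
Proof. exact: sqr_ge0. Qed.

Lemma is_derive_possq x : is_derive x 1 possq (x + `|x|).
Proof.
apply: is_derive_cvg; apply/cvgrPdist_le => e e0.
near=> h.
have h0 : h != 0 by near: h; exact: nbhs_dnbhs_neq.
apply: (@le_trans _ _ `|h|); last first.
  by near: h; exact: dnbhs0_le.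
rewrite -(ler_pM2l (_ : 0 < `|h|)) ?normr_gt0// -normrM.
rewrite mulrBr [X in _ - X](_ : _ = possq (h + x) - possq x); last first.
  by rewrite /GRing.scale/= mulrA mulfV// mul1r.
rewrite -expr2 real_normK ?num_real// /possq ler_norml.
(* The error of the linear approximation is at most h^2, whatever the signs. *)
by case: (ger0P (h + x)) => ?; case: (ger0P x) => ?; apply/andP; split; nra.
Unshelve. all: by end_near. Qed.

Lemma continuous_possq : continuous possq.
Proof.
move=> x; apply: differentiable_continuous; apply/derivable1_diffP.
by have [] := is_derive_possq x.
Qed.

(** With [q] a multiple of a bump supported on [[c, d]], the quotient [q / (1 + q)]
    stays in [[0, 1]] and tends to 1 inside [(c, d)] as the multiple grows. *)
Lemma possq_cutoff_C1c c d (n : R) : 0 <= n ->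
  let p x := let q := n * (possq (x - c) * possq (d - x)) in q / (1 + q) in
  forall a b, a < c -> c < d -> d < b -> C1c a b p.
Proof.
move=> n0 p a b ac cd db.
pose q x := n * (possq (x - c) * possq (d - x)).
pose q' x := n * (possq (x - c) * - (d - x + `|d - x|) +
                  possq (d - x) * (x - c + `|x - c|)).
have q0 x : 0 <= q x by rewrite mulr_ge0// mulr_ge0// possq_ge0.
have q1 x : 1 + q x != 0 by rewrite gt_eqF// (lt_le_trans ltr01)// lerDl.
have dq x : is_derive x 1 q (q' x).
  have d1 : is_derive x 1 (fun y => possq (y - c)) (x - c + `|x - c|).
    rewrite -[X in is_derive _ _ _ X]mulr1.
    apply: (@is_derive1_comp _ possq (fun y => y - c)).
      exact: is_derive_possq.
    by apply: is_derive_eq; rewrite subr0.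
  have d2 : is_derive x 1 (fun y => possq (d - y)) (- (d - x + `|d - x|)).
    have -> : - (d - x + `|d - x|) = (d - x + `|d - x|) * -1 by rewrite mulrN1.
    apply: (@is_derive1_comp _ possq (fun y => d - y)).
      exact: is_derive_possq.
    by apply: is_derive_eq; rewrite add0r mul1r.
  have d3 := is_deriveM d1 d2.
  exact: (is_derive_ext (is_deriveZ n d3)).
have dp x : is_derive x 1 p (q' x / (1 + q x) ^+ 2).
  have d1 : is_derive x 1 (fun y => 1 + q y) (q' x).
    by have d0 := is_deriveD (is_derive_cst (1 : R) x (1 : R)) (dq x);
      apply: (is_derive_ext d0) => //; rewrite add0r.
  have d2 := @is_deriveV R (fun y => 1 + q y) x _ 1 (q1 x) d1.
  have d3 := is_deriveM (dq x) d2.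
  apply: (is_derive_ext d3) => //; rewrite /GRing.scale/=.
  by field.
have cq : continuous q.
  move=> x; apply: differentiable_continuous; apply/derivable1_diffP.
  by have [] := dq x.
split.
- by move=> x; have [] := dp x.
- rewrite (_ : derive1 p = fun x => q' x / (1 + q x) ^+ 2); last first.
    by apply/funext => x; rewrite derive1E; have [] := dp x.
  have cB y : continuous (fun x : R => x - y).
    by move=> x; apply: cvgB; [exact: cvg_id|exact: cvg_cst].
  have cB' y : continuous (fun x : R => y - x).
    by move=> x; apply: cvgB; [exact: cvg_cst|exact: cvg_id].
  have cs y : continuous (fun x => possq (x - y)).
    by move=> x; apply: (continuous_comp (cB y x)); exact: continuous_possq.
  have cs' y : continuous (fun x => possq (y - x)).
    by move=> x; apply: (continuous_comp (cB' y x)); exact: continuous_possq.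
  move=> x; apply: cvgM.
    apply: cvgM; first exact: cvg_cst.
    apply: cvgD; apply: cvgM; [exact: cs| |exact: cs'|].
      apply: cvgN; apply: cvgD; first exact: cB'.
      by apply: cvg_norm; exact: cB'.
    apply: cvgD; first exact: cB.
    by apply: cvg_norm; exact: cB.
  apply: cvgV; first by rewrite expf_neq0.
  by apply: cvgM; apply: cvgD; by [exact: cvg_cst|exact: cq].
- exists c, d; split => // x; rewrite /p.
  move=> /negP; rewrite negb_and -!ltNge => /orP[xc|dx].
    by rewrite possq_eq0 ?mul0r ?mulr0 ?mul0r// subr_le0 ltW.
  by rewrite [possq (d - x)]possq_eq0 ?mul0r ?mulr0 ?mul0r// subr_le0 ltW.
Qed.

(** The cutoffs of [possq_cutoff_C1c] converge boundedly to the indicator of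
    [(c, d)]. *)
Lemma C1c_orthogonal_itv g a b c d : mu.-integrable `]a, b[ (EFin \o g) ->
  (forall p, C1c a b p -> \int[mu]_(x in `]a, b[) (g x * p x) = 0) ->
  a < c -> c < d -> d < b -> \int[mu]_(x in `]c, d[) g x = 0.
Proof.
move=> ig gp ac cd db.
pose q (n : nat) x := n%:R * (possq (x - c) * possq (d - x)).
pose p n x := q n x / (1 + q n x).
have q0 n x : 0 <= q n x by rewrite mulr_ge0// mulr_ge0// possq_ge0.
have q1 n x : 0 < 1 + q n x by rewrite (lt_le_trans ltr01)// lerDl.
have p1 n x : `|p n x| <= 1.
  rewrite ger0_norm ?divr_ge0// ?(ltW (q1 _ _))//.
  by rewrite ler_pdivrMr// mul1r lerDr.
have pC n : C1c a b (p n) by exact: possq_cutoff_C1c.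
have mg : measurable_fun `]a, b[ (EFin \o g) by have /integrableP[] := ig.
have mg' : measurable_fun `]a, b[ g by exact/measurable_EFinP.
have sub : `]c, d[ `<=` `]a, b[ by apply: subset_itv; rewrite bnd_simp ltW.
have mI : measurable_fun `]a, b[ ((EFin \o g) \_ `]c, d[).
  apply/measurable_restrict => //.
  by apply: measurable_funS mg => //; exact: subIsetl.
have pt x : `]a, b[%classic x ->
    (g x * p n x)%:E @[n --> \oo] --> ((EFin \o g) \_ `]c, d[) x.
  move=> _; rewrite patchE; case: ifPn => [/set_mem/=|].
    rewrite in_itv/= => /andP[cx xd].
    apply: cvg_EFin; first exact: nearW.
    rewrite /comp/= -[X in _ --> X]mulr1; apply: cvgM; first exact: cvg_cst.
    have Phi0 : 0 < possq (x - c) * possq (d - x).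
      by rewrite mulr_gt0// possq_gt0// subr_gt0.
    apply/cvgrPdist_le => e e0.
    near=> n.
    rewrite (_ : 1 - p n x = (1 + q n x)^-1); last first.
      by rewrite /p; field; rewrite gt_eqF.
    (* 1 / (1 + q) is below e as soon as q exceeds 1 / e. *)
    rewrite gtr0_norm ?invr_gt0// -[leRHS]invrK lef_pV2 ?posrE ?invr_gt0//.
    rewrite (@le_trans _ _ (q n x)) ?lerDr// /q -ler_pdivrMr//.
    by near: n; exact: nbhs_infty_ger.
  rewrite notin_setE/= in_itv/= => /negP; rewrite negb_and -!leNgt => xcd.
  rewrite (_ : (fun n => _) = fun=> 0%E); first exact: cvg_cst.
  apply/funext => n; rewrite /p /q; case/orP: xcd => h.
    by rewrite possq_eq0 ?subr_le0// !(mul0r,mulr0).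
  by rewrite [possq (d - x)]possq_eq0 ?subr_le0// !(mul0r,mulr0).
have H : (fun n => \int[mu]_(x in `]a, b[) (g x * p n x)%:E)%E @ \oo -->
    (\int[mu]_(x in `]a, b[) ((EFin \o g) \_ `]c, d[) x)%E.
  apply: (@dominated_cvg _ _ _ mu _ _ _ _ (abse \o (EFin \o g))) => //.
  - move=> n; apply/measurable_EFinP; apply: measurable_funM => //.
    apply: measurable_funTS; apply: continuous_measurable_fun => x.
    apply: differentiable_continuous; apply/derivable1_diffP.
    by have [] := pC n.
  - exact: integrable_abse.
  - move=> n x _ /=; rewrite lee_fin normrM.
    by rewrite -[leRHS]mulr1 ler_wpM2l.
rewrite /Rintegral.
suff: (\int[mu]_(x in `]a, b[) ((EFin \o g) \_ `]c, d[) x = 0)%E.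
  by rewrite -integral_mkcondr setIidr// => ->.
suff H0 : (fun n => \int[mu]_(x in `]a, b[) (g x * p n x)%:E)%E @ \oo --> (0 : \bar R).
  exact: (cvg_unique _ H H0).
rewrite (_ : (fun n => _) = fun=> 0%E); first exact: cvg_cst.
apply/funext => n; have := gp _ (pC n); rewrite /Rintegral => /eqP.
rewrite fine_eq0; first by move/eqP.
apply: integrable_fin_num => //.
apply: (@integrable_mul_bounded _ _ _ _ 1) => //.
apply: measurable_funTS; apply: continuous_measurable_fun => x.
apply: differentiable_continuous; apply/derivable1_diffP.
by have [] := pC n.
Unshelve. all: by end_near. Qed.

(** All integrals over subintervals vanish, so the primitive of [g] is locally
    constant, while by Lebesgue differentiation its derivative is [g] almost
    everywhere. *)
Lemma C1c_orthogonal_ae0 g a b : a < b -> mu.-integrable `]a, b[ (EFin \o g) ->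
  (forall p, C1c a b p -> \int[mu]_(x in `]a, b[) (g x * p x) = 0) ->
  aeOn `]a, b[ (fun x => g x = 0).
Proof.
move=> ab ig gp; pose G := g \_ `]a, b[.
have iG : mu.-integrable setT (EFin \o G).
  by rewrite /G -restrict_EFin -integrable_mkcond.
have Ny y : mu.-integrable `]-oo, y] (EFin \o G).
  by apply: integrableS iG.
have loc : locally_integrable [set: R] G.
  by apply: integrable_locally_restrict.
have [N [mN N0 HN]] := FTC1Ny Ny loc.
exists N; split => //; apply: subset_trans HN.
apply: subsetC => x /= [dF F'] xab.
have GE : G x = g x by rewrite /G patchE mem_set.
rewrite -GE -F' derive1E.
pose F y := \int[mu]_(t in `]-oo, y]) G t.
have FE y z : a < y -> y < z -> z < b -> F y = F z.
  move=> ay yz zb; apply/esym/eqP; rewrite -subr_eq0 /F.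
  rewrite (@Rintegral_itvB _ _ -oo%O (BRight z) y) ?bnd_simp ?ltW//.
  rewrite -Rintegral_itv_bndo_bndc; last first.
    by apply: integrableS iG.
  apply/eqP; rewrite -[RHS](C1c_orthogonal_itv ig gp ay yz zb).
  apply: eq_Rintegral => t /set_mem/=; rewrite in_itv/= => /andP[yt tz].
  by rewrite /G patchE mem_set//= in_itv/= (lt_trans ay)// (lt_trans tz).
rewrite (@near_eq_derive _ _ _ F (cst (F x)))//; first exact: derive_cst.
move: (xab); rewrite /= in_itv/= => /andP[ax xb].
near=> y.
have : y \in `]a, b[ by near: y; exact: near_in_itvoo.
rewrite in_itv/= => /andP[ay yb].
have [xy|yx|->//] := ltgtP x y; first by rewrite /= -(FE x y).
by rewrite /= (FE y x).
Unshelve. all: by end_near. Qed.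

End FundamentalLemma.

(** * Interchanging an integral with a primitive *)

Section Fubini.
Context {R : realType}.
Local Notation mu := (@lebesgue_measure R).
Implicit Types (g r : R -> R) (a b x y : R).

(** Fubini on the triangle [x < y].  This serves as integration by parts when
    one factor is merely the primitive of an integrable function, and with
    [r = 1] it computes the mean of a primitive. *)
Lemma Rintegral_primitive_swap g r a b M : mu.-integrable `]a, b[ (EFin \o g) ->
  measurable_fun `]a, b[ r -> (forall x, `]a, b[%classic x -> `|r x| <= M) ->
  \int[mu]_(y in `]a, b[) (r y * \int[mu]_(x in `]a, y[) g x) =
  \int[mu]_(x in `]a, b[) (g x * \int[mu]_(y in `]x, b[) r y).
Proof.
move=> ig mr rM.
pose G := g \_ `]a, b[; pose r' := r \_ `]a, b[.
have mg : measurable_fun `]a, b[ g by have /integrableP[/measurable_EFinP] := ig.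
have mG : measurable_fun setT G by exact/(measurable_restrictT _ (measurable_itv _)).
have mr' : measurable_fun setT r' by exact/(measurable_restrictT _ (measurable_itv _)).
have iG : mu.-integrable setT (EFin \o G).
  by rewrite /G -restrict_EFin -integrable_mkcond.
(* The integrand extended by zero to the plane. *)
pose f (z : measurableTypeR R * measurableTypeR R) :=
  (if z.1 < z.2 then G z.1 * r' z.2 else 0)%:E.
have mf : measurable_fun setT f.
  apply/measurable_EFinP; apply: measurable_fun_ifT => //.
  - exact: measurable_fun_ltr.
  - apply: measurable_funM.
    + exact: measurableT_comp mG measurable_fst.
    + exact: measurableT_comp mr' measurable_snd.
have ir x : x \in `]a, b[ -> mu.-integrable `]x, b[ (EFin \o r).
  rewrite in_itv/= => /andP[ax xb].
  have sub : `]x, b[ `<=` `]a, b[ by apply: subset_itvr; rewrite bnd_simp ltW.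
  apply: (@bounded_integrable _ _ _ M) => //.
  - exact: itv_measure_lty.
  - exact: measurable_funS mr.
  - by move=> z xz; apply: rM; exact: sub.
have ir' : mu.-integrable setT (EFin \o r').
  rewrite /r' -restrict_EFin -integrable_mkcond//.
  by apply: (@bounded_integrable _ _ _ M) => //; exact: itv_measure_lty.
have ig' y : y \in `]a, b[ -> mu.-integrable `]a, y[ (EFin \o g).
  rewrite in_itv/= => /andP[ay yb]; apply: integrableS ig => //.
  by apply: subset_itvl; rewrite bnd_simp ltW.
have fi : (mu \x mu)%E.-integrable setT f.
  have mh : measurable_fun setT
      (fun z : measurableTypeR R * measurableTypeR R => (G z.1 * r' z.2)%:E).
    apply/measurable_EFinP; apply: measurable_funM.
    + exact: measurableT_comp mG measurable_fst.
    + exact: measurableT_comp mr' measurable_snd.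
  apply: (@le_integrable _ _ R (mu \x mu)%E setT measurableT f
    (fun z => (G z.1 * r' z.2)%:E)) => //.
    by move=> z _; rewrite /f /=; case: ifPn => // _; rewrite normr0 lee_fin.
  apply/(integrable12ltyP _ _ mh) => /=.
  under eq_integral => x _.
    under eq_integral => y _ do rewrite normrM EFinM.
    rewrite ge0_integralZl_EFin//; last first.
      by do 2! apply: measurableT_comp => //.
    over.
  have /integrableP[_ Goo] := iG; have /integrableP[_ roo] := ir'.
  rewrite ge0_integralZr//; last 2 first.
  - by do 2! apply: measurableT_comp => //.
  - exact: integral_ge0.
  apply: lte_mul_pinfty => //; first exact: integral_ge0.
  by rewrite ge0_fin_numE//; exact: integral_ge0.
have key D h (k : R) : measurable D -> mu.-integrable D (EFin \o h) ->
    (\int[mu]_y (k * (h \_ D) y)%:E)%E = (k * \int[mu]_(y in D) h y)%:E.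
  move=> mD ih; rewrite EFinM EFin_Rintegral// [in RHS]integral_mkcond restrict_EFin.
  under [LHS]eq_integral do rewrite EFinM.
  have ih' : mu.-integrable setT (EFin \o (h \_ D)).
    by rewrite -restrict_EFin -integrable_mkcond.
  by rewrite (@integralZl _ _ _ mu _ measurableT _ ih').
have E1 x : (\int[mu]_y f (x, y))%E =
    (EFin \o ((fun x => g x * \int[mu]_(y in `]x, b[) r y) \_ `]a, b[)) x.
  rewrite /= patchE; case: ifPn => xab; last first.
    rewrite -[RHS](integral0 mu setT); apply: eq_integral => y _.
    by rewrite /f/= /G patchE (negbTE xab) mul0r if_same.
  have /= := xab; rewrite inE/= => xab'; rewrite -key//; last exact: ir.
  apply: eq_integral => y _; rewrite /f/= /G /r' !patchE xab.
  have /andP[ax xb] : a < x < b by move: xab'; rewrite in_itv.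
  congr EFin; rewrite !mem_setE !in_itv/=; case: ltP => xy /=; last by rewrite mulr0.
  by rewrite (lt_trans ax xy); case: ifPn => //; rewrite mulr0.
have E2 y : (\int[mu]_x f (x, y))%E =
    (EFin \o ((fun y => r y * \int[mu]_(x in `]a, y[) g x) \_ `]a, b[)) y.
  rewrite /= patchE; case: ifPn => yab; last first.
    rewrite -[RHS](integral0 mu setT); apply: eq_integral => x _.
    by rewrite /f/= /r' patchE (negbTE yab) mulr0 if_same.
  have /= := yab; rewrite inE/= => yab'; rewrite -key//; last exact: ig'.
  apply: eq_integral => x _; rewrite /f/= /G /r' !patchE yab.
  have /andP[ay yb] : a < y < b by move: yab'; rewrite in_itv.
  congr EFin; rewrite !mem_setE !in_itv/= mulrC; case: ltP => xy /=; last first.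
    by rewrite andbF mulr0.
  by rewrite (lt_trans xy yb) !andbT; case: ifPn => //; rewrite mulr0.
have := Fubini fi.
under eq_integral do rewrite E1.
under [X in _ = X -> _]eq_integral do rewrite E2.
by rewrite -!restrict_EFin -!integral_mkcond /Rintegral => <-.
Qed.
End Fubini.

(** * Continuous functions and test functions on an interval *)

Section OneVariable.
Context {R : realType}.
Local Notation mu := (@lebesgue_measure R).
Implicit Types (f g p s : R -> R) (a b c d x y : R).

Lemma within_continuousP f a b : {within `[a, b], continuous f} <->
  forall x, a <= x <= b -> f y @[y --> within `[a, b] (nbhs x)] --> f x.
Proof.
split=> [/subspace_continuousP cf x xab|cf]; first by apply: cf; rewrite /= in_itv.
by apply/subspace_continuousP => x xab; apply: cf; move: xab; rewrite /= in_itv.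
Qed.

Lemma continuous_itv_bounded f a b : a <= b -> {within `[a, b], continuous f} ->
  exists M, forall x, a <= x <= b -> `|f x| <= M.
Proof.
move=> ab cf; have [c _ fc] := EVT_max ab cf; have [d _ fd] := EVT_min ab cf.
exists (`|f c| + `|f d|) => x xab; have xi : x \in `[a, b] by rewrite in_itv.
have := fc _ xi; have := fd _ xi.
have := ler_norm (f c); have := ler_norm (- f d); rewrite normrN.
have := normr_ge0 (f c); have := normr_ge0 (f d).
by move=> *; rewrite ler_norml; apply/andP; split; lra.
Qed.

Lemma within_itv_ooW f a b : {within `[a, b], continuous f} ->
  {within `]a, b[, continuous f}.
Proof. by apply: continuous_subspaceW; apply: subset_itv; rewrite bnd_simp. Qed.

Lemma within_measurable f a b : {within `[a, b], continuous f} ->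
  measurable_fun `]a, b[ f.
Proof.
by move/within_itv_ooW => cf; apply: subspace_continuous_measurable_fun.
Qed.

Lemma within_integrable f a b : a <= b -> {within `[a, b], continuous f} ->
  mu.-integrable `]a, b[ (EFin \o f).
Proof.
move=> ab cf; have [M fM] := continuous_itv_bounded ab cf.
apply: (@bounded_integrable _ _ _ M) => //.
- exact: itv_measure_lty.
- exact: within_measurable.
- by move=> x /=; rewrite in_itv/= => /andP[/ltW ax /ltW xb]; rewrite fM ?ax.
Qed.

Lemma within_L2on f a b : a <= b -> {within `[a, b], continuous f} ->
  L2on `]a, b[ f.
Proof.
move=> ab cf; have [M fM] := continuous_itv_bounded ab cf.
apply: (@L2on_bounded _ _ _ M) => //.
- exact: itv_measure_lty.
- exact: within_measurable.
- by move=> x /=; rewrite in_itv/= => /andP[/ltW ax /ltW xb]; rewrite fM ?ax.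
Qed.

(** Two values that differed would differ on a nondegenerate interval, which has
    positive measure.  The closed end points are included: this is what turns
    identities for almost every time into identities for every time. *)
Lemma ae_continuous_eq f g a b : a < b ->
  {within `[a, b], continuous f} -> {within `[a, b], continuous g} ->
  aeOn `]a, b[ (fun x => f x = g x) -> forall x, a <= x <= b -> f x = g x.
Proof.
move=> ab cf cg [N [mN N0 HN]] x xab; apply/eqP; rewrite -subr_eq0.
have [//|fg] := eqVneq (f x - g x) 0.
have ck : (f y - g y) @[y --> within `[a, b] (nbhs x)] --> f x - g x.
  by apply: cvgB; [move/within_continuousP: cf|move/within_continuousP: cg]; exact.
have /cvgrPdist_lt/(_ `|f x - g x|) := ck; rewrite normr_gt0 => /(_ fg).
rewrite /within/= => -[e /= e0 He]; exfalso.
pose l := Num.max a (x - e); pose r := Num.min b (x + e).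
have lr : l < r.
  by rewrite /l /r gt_max !lt_min; case/andP: xab => ? ?; apply/andP; split;
    apply/andP; split; lra.
have sub : `]l, r[ `<=` N.
  move=> y /=; rewrite in_itv/= /l /r gt_max lt_min => /andP[/andP[ay xy] /andP[yb yx]].
  apply: HN => /= H; have yab : y \in `]a, b[ by rewrite in_itv/= ay.
  have xye : `|x - y| < e by rewrite ltr_distlC; apply/andP; split; lra.
  have /= := He y xye; rewrite H// subrr subr0 ltxx in_itv/= (ltW ay) (ltW yb).
  by move=> /(_ isT).
have : (mu `]l, r[ <= mu N)%E by apply: le_measure => //; rewrite inE.
by rewrite N0 lebesgue_measure_itv/= lte_fin lr -EFinB lee_fin leNgt subr_gt0 lr.
Qed.

Lemma C1c_continuous a b p : C1c a b p -> continuous p.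
Proof.
case=> dp _ _ x; apply: differentiable_continuous; apply/derivable1_diffP.
exact: dp.
Qed.

Lemma C1c_out a b p x : C1c a b p -> ~ (a < x < b) -> p x = 0.
Proof.
case=> _ _ [c [d [ac db p0]]] xab; apply: p0 => /andP[cx xd]; apply: xab.
by rewrite (lt_le_trans ac)//= (le_lt_trans xd).
Qed.

Lemma C1c_Rintegral_derive a b p x y : C1c a b p -> x < y ->
  \int[mu]_(t in `]x, y[) derive1 p t = p y - p x.
Proof.
move=> pC xy; have [dp cp _] := pC.
have cw : {within `[x, y], continuous (derive1 p)} by exact: continuous_subspaceT.
have cpw := C1c_continuous pC.
rewrite /Rintegral -(@integral_itv_bndoo _ x y _ true false); last first.
  by apply/measurable_EFinP; exact: within_measurable.
rewrite (@continuous_FTC2 _ _ p)//.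
split; [by move=> z _; exact: dp| |].
  by apply: cvg_at_right_filter; exact: cpw.
by apply: cvg_at_left_filter; exact: cpw.
Qed.

(** The primitive vanishes beyond the support of [s] because the mean of [s] is
    zero. *)
Lemma C1c_primitive s a b c d : a < c -> c <= d -> d < b -> continuous s ->
  (forall x, ~ (c <= x <= d) -> s x = 0) -> \int[mu]_(x in `]a, b[) s x = 0 ->
  exists2 p, C1c a b p & derive1 p = s.
Proof.
move=> ac cd db cs s0 is0.
have iT : mu.-integrable setT (EFin \o s).
  rewrite (_ : EFin \o s = (EFin \o s) \_ `[c, d]).
    rewrite -integrable_mkcond//; apply: continuous_compact_integrable.
      exact: segment_compact.
    exact: continuous_subspaceT.
  apply/funext => x; rewrite patchE; case: ifPn => //.
  by rewrite notin_setE/= in_itv/= => /s0 /= ->.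
have iS D : measurable D -> mu.-integrable D (EFin \o s).
  by move=> mD; apply: integrableS iT.
pose p x := \int[mu]_(t in `]-oo, x]) s t.
have pE x : derivable p x 1 /\ derive1 p x = s x.
  apply: (@continuous_FTC1 _ s -oo%O x (x + 1)) => //.
  - by rewrite ltrDl.
  - exact: iS.
  - by rewrite ltNyr.
  - exact: cs.
have Dp : derive1 p = s by apply/funext => x; have [] := pE x.
exists p => //; split; [by move=> x; have [] := pE x|by rewrite Dp|].
exists c, d; split => // x /negP; rewrite negb_and -!ltNge => /orP[xc|dx].
  rewrite /p; under eq_Rintegral => t.
    rewrite inE/= in_itv/= => tx; rewrite s0; last first.
      by move=> /andP[ct _]; have := lt_le_trans xc ct; rewrite ltNge tx.
    over.
  by rewrite Rintegral_cst// mul0r.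
have sE D : measurable D -> `[c, d] `<=` D ->
    \int[mu]_(t in D) s t = \int[mu]_(t in `[c, d]) s t.
  move=> mD cdD; rewrite Rintegral_mkcond [RHS]Rintegral_mkcond.
  apply: eq_Rintegral => t _; rewrite !patchE; case: ifPn => tD; case: ifPn => //.
    by rewrite notin_setE/= in_itv/= => /s0.
  by move/set_mem => /cdD; move: tD => /negP tD /mem_set.
rewrite /p sE//; first by rewrite -(sE `]a, b[%classic)//; apply: subset_itv; rewrite bnd_simp.
by apply: subset_itv; rewrite ?bnd_simp// ltW.
Qed.

End OneVariable.

Section WeakDerivative.
Context {R : realType}.
Local Notation mu := (@lebesgue_measure R).
Implicit Types (f g h p q : R -> R) (a b c d x y : R).

Lemma C1c_within a b p : C1c a b p -> {within `[a, b], continuous p}.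
Proof. by move=> pC; apply: continuous_subspaceT; exact: C1c_continuous pC. Qed.

Lemma C1c_derive_within a b p : C1c a b p -> {within `[a, b], continuous (derive1 p)}.
Proof. by case=> _ cp _; exact: continuous_subspaceT. Qed.

Lemma L2on_mul_continuous_integrable f p a b : a <= b -> L2on `]a, b[ f ->
  {within `[a, b], continuous p} ->
  mu.-integrable `]a, b[ (EFin \o (fun x => f x * p x)).
Proof.
by move=> ab hf cp; apply: L2on_mul_integrable => //; exact: within_L2on.
Qed.

(** The du Bois-Reymond lemma: every test function, corrected by a multiple of
    a fixed one to have mean zero, is the derivative of a test function. *)
Lemma orthogonal_derive_cst f a b : a < b -> L2on `]a, b[ f ->
  (forall p, C1c a b p -> \int[mu]_(x in `]a, b[) (f x * derive1 p x) = 0) ->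
  exists c, aeOn `]a, b[ (fun x => f x = c).
Proof.
move=> ab hf fp; have ab' := ltW ab.
have mab : measurable (`]a, b[%classic : set R) by [].
have L21 : L2on `]a, b[ (cst (1 : R)).
  by apply: (within_L2on ab'); apply: continuous_subspaceT => x; exact: cvg_cst.
have iprod := L2on_mul_continuous_integrable ab' hf.
have [[eta etaC eta0]|noeta] := pselect (exists2 eta, C1c a b eta &
    \int[mu]_(x in `]a, b[) eta x != 0); last first.
  (* If every test function had mean zero, the constant 1 would vanish almost
     everywhere. *)
  exists 0; suff : aeOn `]a, b[ (fun x : R => (1 : R) = 0).
    by apply: aeOnS => x _ /eqP; rewrite oner_eq0.
  apply: C1c_orthogonal_ae0 => //; first exact: L2on_integrable (itv_measure_lty _ _ _ _) L21.
  move=> p pC; under eq_Rintegral do rewrite mul1r.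
  by apply: contra_notP noeta => /eqP; exists p.
set m := \int[mu]_(x in _) _ in eta0.
pose c := (\int[mu]_(x in `]a, b[) (f x * eta x)) / m; exists c.
have L2k : L2on `]a, b[ (fun x => f x - c * 1) by apply: L2onB => //; exact: L2onZ.
suff : aeOn `]a, b[ (fun x => f x - c * 1 = 0).
  by apply: aeOnS => x _ /eqP; rewrite mulr1 subr_eq0 => /eqP.
apply: C1c_orthogonal_ae0 => //.
  exact: (L2on_integrable mab (itv_measure_lty _ _ _ _) L2k).
move=> q qC.
pose l := (\int[mu]_(x in `]a, b[) q x) / m.
have iq : mu.-integrable `]a, b[ (EFin \o q).
  by apply: (within_integrable ab'); exact: C1c_within qC.
have ie : mu.-integrable `]a, b[ (EFin \o eta).
  by apply: (within_integrable ab'); exact: C1c_within etaC.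
have is0 : \int[mu]_(x in `]a, b[) (q x - l * eta x) = 0.
  rewrite RintegralB//; last exact: integrable_scale.
  by rewrite RintegralZl// -/m /l divfK// subrr.
have [_ _ [c1 [d1 [ac1 db1 q0]]]] := qC; have [_ _ [c2 [d2 [ac2 db2 e0]]]] := etaC.
have [p pC pE] : exists2 p, C1c a b p & derive1 p = (fun x => q x - l * eta x).
  have [cd|dc] := leP (Num.min c1 c2) (Num.max d1 d2).
    apply: (@C1c_primitive _ _ a b (Num.min c1 c2) (Num.max d1 d2)) => //.
    - by rewrite lt_min ac1.
    - by rewrite gt_max db1.
    - move=> x; apply: cvgB; first exact: C1c_continuous qC x.
      by apply: cvgM; [exact: cvg_cst|exact: C1c_continuous etaC x].
    - move=> x xcd; rewrite q0 ?e0 ?mulr0 ?subr0// => /andP[cx xd]; apply: xcd.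
        by rewrite ge_min le_max cx xd !orbT.
      by rewrite ge_min le_max cx xd.
  (* An empty enclosing interval would force eta to vanish identically. *)
  exfalso; move/eqP: eta0; apply; rewrite /m.
  under eq_Rintegral => x _.
    rewrite e0; last first.
      move=> /andP[cx xd]; move: dc; rewrite ltNge => /negP; apply.
      by rewrite ge_min [c2 <= _]le_max (le_trans cx xd) !orbT.
    over.
  by rewrite Rintegral_cst// mul0r.
have := fp _ pC; rewrite pE.
under eq_Rintegral do rewrite mulrBr mulrCA.
rewrite RintegralB//; last 2 first.
- by apply: iprod; exact: C1c_within qC.
- by apply: integrable_scale => //; apply: iprod; exact: C1c_within etaC.
rewrite RintegralZl//; last by apply: iprod; exact: C1c_within etaC.
move=> H.
under eq_Rintegral do rewrite mulr1 mulrBl.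
rewrite RintegralB//; last 2 first.
- by apply: iprod; exact: C1c_within qC.
- exact: integrable_scale.
rewrite RintegralZl//; move: H; rewrite /l /c => <-; field.
exact: eta0.
Qed.

Lemma primitive_continuous g a b : a < b -> mu.-integrable `]a, b[ (EFin \o g) ->
  {within `[a, b], continuous (fun x => \int[mu]_(t in `]a, x[) g t)}.
Proof.
move=> ab ig; pose G := g \_ `]a, b[.
have iG : mu.-integrable setT (EFin \o G).
  by rewrite /G -restrict_EFin -integrable_mkcond.
have iGab : mu.-integrable `[a, b] (EFin \o G) by apply: integrableS iG.
have := parameterized_integral_continuous (ltW ab) iGab.
rewrite /parameterized_integral => H.
apply/within_continuousP => x xab.
have E y : a <= y <= b ->
    \int[mu]_(t in `[a, y]) G t = \int[mu]_(t in `]a, y[) g t.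
  move=> /andP[ay yb]; rewrite -Rintegral_itv_bndo_bndc; last by apply: integrableS iG.
  rewrite -Rintegral_itv_obnd_cbnd; last by apply: integrableS iG.
  apply: eq_Rintegral => t; rewrite inE/= in_itv/= => /andP[ta ty].
  by rewrite /G patchE mem_set//= in_itv/= ta (lt_le_trans ty).
rewrite -(E _ xab).
have /within_continuousP/(_ _ xab) := H.
apply: cvg_trans; apply: near_eq_cvg.
by rewrite near_withinE; near=> y => yab; rewrite E//; move: yab; rewrite /= in_itv.
Unshelve. all: by end_near. Qed.

(** Integration by parts when only one factor is smooth, obtained from
    [Rintegral_primitive_swap] with [r] the derivative of [p]. *)
Lemma Rintegral_primitive_C1c g p a b : a < b -> L2on `]a, b[ g -> C1c a b p ->
  \int[mu]_(y in `]a, b[) ((\int[mu]_(x in `]a, y[) g x) * derive1 p y) =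
  - \int[mu]_(x in `]a, b[) (g x * p x).
Proof.
move=> ab hg pC; have cdp := C1c_derive_within pC.
have [M HM] := continuous_itv_bounded (ltW ab) cdp.
have ig : mu.-integrable `]a, b[ (EFin \o g).
  by apply: L2on_integrable => //; exact: itv_measure_lty.
under eq_Rintegral do rewrite mulrC.
rewrite (Rintegral_primitive_swap (M := M) ig)//; last 2 first.
- exact: within_measurable.
- by move=> x /=; rewrite in_itv/= => /andP[/ltW ax /ltW xb]; apply: HM; rewrite ax.
rewrite -[RHS]mulN1r -RintegralZl//; last first.
  exact: (L2on_mul_continuous_integrable (ltW ab) hg (C1c_within pC)).
apply: eq_Rintegral => x; rewrite inE/= in_itv/= => /andP[ax xb].
rewrite (C1c_Rintegral_derive pC)// (C1c_out pC (x := b)) ?ltxx ?andbF//.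
by ring.
Qed.

End WeakDerivative.

(** * Weak derivatives and boundary values on the unit interval *)

Section InnerProduct.
Context {R : realType}.
Local Notation mu := (@lebesgue_measure R).
Local Notation I := (`]0, 1[%classic : set R).
Implicit Types (f g h v : R -> R) (c x : R).

(** The [L^2] pairing; fixing its second argument turns statements about functions
    of time with values in [L^2] into statements about numbers. *)
Definition ip f v : R := intI (fun x => f x * v x).

Lemma eqI_sym f g : eqI f g -> eqI g f.
Proof. by apply: aeOnS => x _. Qed.

Lemma eqI_trans f g h : eqI f g -> eqI g h -> eqI f h.
Proof. by move=> fg gh; apply: aeOnS (aeOnI fg gh) => x _ [-> ->]. Qed.

Lemma eqI_refl f : eqI f f.
Proof. by exists set0; split => // x /= []. Qed.

Lemma intI_eqI f g : measurable_fun I f -> measurable_fun I g -> eqI f g ->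
  intI f = intI g.
Proof.
move=> mf mg fg; rewrite /intI /Rintegral; congr fine.
by apply: ae_eq_integral => //; [exact/measurable_EFinP|exact/measurable_EFinP|
   apply: aeOnS fg => x _ ->].
Qed.

Lemma L2norm_eqI f g : L2on I f -> L2on I g -> eqI f g -> L2norm f = L2norm g.
Proof.
move=> hf hg fg; rewrite /L2norm; congr fine; rewrite unlock; congr (_ `^ _)%E.
have E h : (\int[mu]_x (`|(EFin \o h \_ I) x| `^ 2))%E =
    (\int[mu]_(x in I) (`|h x| `^ 2)%:E)%E.
  rewrite [RHS]integral_mkcond; apply: eq_integral => x _ /=.
  by rewrite !patchE; case: ifPn => //; rewrite normr0 powR0.
rewrite !E; apply: ae_eq_integral => //.
- apply/measurable_EFinP; apply: (measurableT_comp (measurable_powR _)) => //.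
  by apply: measurableT_comp => //; exact: L2on_measurable.
- apply/measurable_EFinP; apply: (measurableT_comp (measurable_powR _)) => //.
  by apply: measurableT_comp => //; exact: L2on_measurable.
- by apply: aeOnS fg => x _ ->.
Qed.

Lemma ip_eqI f g v : L2on I f -> L2on I g -> L2on I v -> eqI f g -> ip f v = ip g v.
Proof.
move=> hf hg hv fg; apply: intI_eqI; last by apply: aeOnS fg => x _ ->.
- by apply: measurable_funM; exact: L2on_measurable.
- by apply: measurable_funM; exact: L2on_measurable.
Qed.

Lemma ipD f g v : L2on I f -> L2on I g -> L2on I v ->
  ip (fun x => f x + g x) v = ip f v + ip g v.
Proof.
move=> hf hg hv; rewrite /ip /intI.
under eq_Rintegral do rewrite mulrDl.
by rewrite RintegralD//; exact: L2on_mul_integrable.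
Qed.

Lemma ipZ c f v : L2on I f -> L2on I v -> ip (fun x => c * f x) v = c * ip f v.
Proof.
move=> hf hv; rewrite /ip /intI.
under eq_Rintegral do rewrite -mulrA.
by rewrite RintegralZl//; exact: L2on_mul_integrable.
Qed.

Lemma ipB f g v : L2on I f -> L2on I g -> L2on I v ->
  ip (fun x => f x - g x) v = ip f v - ip g v.
Proof.
move=> hf hg hv; rewrite /ip /intI.
under eq_Rintegral do rewrite mulrBl.
by rewrite RintegralB//; exact: L2on_mul_integrable.
Qed.

Lemma ip_le f v : L2on I f -> L2on I v -> `|ip f v| <= L2norm f * L2norm v.
Proof. exact: cauchy_schwarz. Qed.

Lemma L2norm_ge0 f : 0 <= L2norm f.
Proof. by rewrite /L2norm fine_ge0// Lnorm_ge0. Qed.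

Lemma C1c_L2on p : C1c 0 1 p -> L2on I p.
Proof. by move=> pC; apply: within_L2on => //; exact: C1c_within pC. Qed.

Lemma C1c_derive_L2on p : C1c 0 1 p -> L2on I (derive1 p).
Proof. by move=> pC; apply: within_L2on => //; exact: C1c_derive_within pC. Qed.

Lemma ip_C1c_eqI0 f : L2on I f -> (forall p, C1c 0 1 p -> ip f p = 0) ->
  eqI f (fun=> 0).
Proof.
move=> hf fp; apply: C1c_orthogonal_ae0 => //.
by apply: L2on_integrable => //; exact: itv_measure_lty.
Qed.

Lemma L2on_cst c : L2on I (fun=> c).
Proof.
apply: (@L2on_bounded _ _ _ `|c|) => //; exact: itv_measure_lty.
Qed.

Lemma L2on_id : L2on I (fun x => x).
Proof.
apply: (@L2on_bounded _ _ _ 1) => //; first exact: itv_measure_lty.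
by move=> x /=; rewrite in_itv/= => /andP[x0 x1]; rewrite ger0_norm ltW.
Qed.

End InnerProduct.

Section Sobolev.
Context {R : realType}.
Local Notation mu := (@lebesgue_measure R).
Local Notation I := (`]0, 1[%classic : set R).
Implicit Types (f g h v : R -> R) (c x : R).

Lemma is_wderiv_unique f g h : L2on I g -> L2on I h ->
  is_wderiv f g -> is_wderiv f h -> eqI g h.
Proof.
move=> hg hh fg fh.
have : eqI (fun x => g x - h x) (fun=> 0).
  apply: ip_C1c_eqI0 => [|p pC]; first exact: L2onB.
  rewrite ipB//; last exact: C1c_L2on.
  by apply/eqP; rewrite subr_eq0 -eqr_opp -fg// -fh.
by apply: aeOnS => x _ /eqP; rewrite subr_eq0 => /eqP.
Qed.

Lemma is_wderiv_eqI f f' g : L2on I f -> L2on I f' -> eqI f f' ->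
  is_wderiv f g -> is_wderiv f' g.
Proof.
move=> hf hf' ff' fg p pC; rewrite -fg//; apply/esym/ip_eqI => //.
exact: C1c_derive_L2on.
Qed.

Lemma is_wderivB f f' g g' : L2on I f -> L2on I f' -> L2on I g -> L2on I g' ->
  is_wderiv f g -> is_wderiv f' g' ->
  is_wderiv (fun x => f x - f' x) (fun x => g x - g' x).
Proof.
move=> hf hf' hg hg' fg fg' p pC.
have hp := C1c_L2on pC; have hdp := C1c_derive_L2on pC.
rewrite -[LHS]/(ip _ (derive1 p)) -[X in - X]/(ip _ p) !ipB//.
by rewrite [ip f _]fg// [ip f' _]fg'// opprB opprK addrC.
Qed.

Lemma wderivP f : (exists2 g, L2on I g & is_wderiv f g) ->
  L2on I (wderiv f) /\ is_wderiv f (wderiv f).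
Proof.
move=> [g hg fg]; rewrite /wderiv.
by apply: (@xgetPex _ (fun=> 0)
  [set g : R -> R | L2on `]0, 1[ g /\ is_wderiv f g]); exists g.
Qed.

(** An equality of functions and not only of classes, since [wderiv] is chosen
    among all weak derivatives and this set depends only on the class. *)
Lemma wderiv_eqI f f' : L2on I f -> L2on I f' -> eqI f f' -> wderiv f = wderiv f'.
Proof.
move=> hf hf' ff'; rewrite /wderiv; congr (xget _ _).
apply/seteqP; split => g /= [hg fg]; split => //.
  exact: is_wderiv_eqI fg.
by apply: is_wderiv_eqI fg => //; exact: eqI_sym.
Qed.

Lemma wderivnS k f : wderivn k.+1 f = wderivn k (wderiv f).
Proof. by rewrite /wderivn iterSr. Qed.

Lemma wderivn_eqI k f f' : L2on I f -> L2on I f' -> eqI f f' ->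
  eqI (wderivn k f) (wderivn k f').
Proof.
case: k => // k hf hf' ff'; rewrite !wderivnS (wderiv_eqI hf hf' ff').
exact: eqI_refl.
Qed.

Lemma inH_L2on k f : inH k f -> L2on I f.
Proof. by case: k => //= k []. Qed.

Lemma inH_eqI k f f' : inH k f -> eqI f f' -> L2on I f' -> inH k f'.
Proof.
case: k => //= k [hf [g fg Hg]] ff' hf'; split => //; exists g => //.
exact: is_wderiv_eqI fg.
Qed.

Lemma inHS_wderiv k f : inH k.+1 f -> is_wderiv f (wderiv f) /\ inH k (wderiv f).
Proof.
move=> /= [hf [g fg Hg]]; have hg := inH_L2on Hg.
have [hw fw] : L2on I (wderiv f) /\ is_wderiv f (wderiv f) by apply: wderivP; exists g.
by split => //; apply: inH_eqI Hg _ _ => //; exact: is_wderiv_unique fg fw.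
Qed.

Lemma inH_wderivn k j f : inH (k + j) f -> inH j (wderivn k f).
Proof. by elim: k f => //= k IH f /inHS_wderiv[_ /IH]; rewrite -wderivnS. Qed.

Lemma inH_wderivn_L2on k j f : (j <= k)%N -> inH k f -> L2on I (wderivn j f).
Proof.
by move=> jk; rewrite -(subnKC jk) => /inH_wderivn; exact: inH_L2on.
Qed.

Lemma inH_is_wderivn k j f : (j < k)%N -> inH k f ->
  is_wderiv (wderivn j f) (wderivn j.+1 f).
Proof.
move=> jk; rewrite -(subnKC jk) addSnnS => /inH_wderivn.
by rewrite -/(iter _ _ _) => /inHS_wderiv[].
Qed.

(** The weak derivative is a choice of representative, so it is linear only
    almost everywhere. *)
Lemma wderivnB k j f g : (j <= k)%N -> inH k f -> inH k g ->
  eqI (wderivn j (f - g)) (fun x => wderivn j f x - wderivn j g x).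
Proof.
elim: j k f g => [|j IH] [|k] f g // jk; [by move=> _ _; exact: eqI_refl..|].
move=> /[dup] /inH_L2on hf /inHS_wderiv[fw Hf].
move=> /[dup] /inH_L2on hg /inHS_wderiv[gw Hg].
rewrite !wderivnS.
have hwf := inH_L2on Hf; have hwg := inH_L2on Hg.
have hB : L2on I (wderiv f - wderiv g) by exact: L2onB.
have wB : is_wderiv (f - g) (wderiv f - wderiv g) by exact: is_wderivB.
have [hw fgw] : L2on I (wderiv (f - g)) /\ is_wderiv (f - g) (wderiv (f - g)).
  by apply: wderivP; exists (wderiv f - wderiv g).
apply: eqI_trans (IH k _ _ jk Hf Hg); apply: wderivn_eqI => //.
exact: is_wderiv_unique fgw wB.
Qed.

Lemma inHB k f g : inH k f -> inH k g -> inH k (f - g).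
Proof.
elim: k f g => [|k IH] f g; first exact: L2onB.
move=> [hf [f1 ff1 Hf1]] [hg [g1 gg1 Hg1]]; split; first exact: L2onB.
exists (f1 - g1); last exact: IH.
by apply: is_wderivB => //; [exact: inH_L2on Hf1|exact: inH_L2on Hg1].
Qed.

Lemma Hnorm_ge k j f : (j <= k)%N -> L2norm (wderivn j f) <= Hnorm k f.
Proof.
rewrite -ltnS => jk; rewrite /Hnorm -[leLHS]ger0_norm ?L2norm_ge0// -sqrtr_sqr.
rewrite ler_sqrt ?sumr_ge0// => [|i _]; last exact: sqr_ge0.
by rewrite (bigD1 (Ordinal jk))//= lerDl sumr_ge0// => i _; exact: sqr_ge0.
Qed.

Lemma C1c_is_wderiv (p : R -> R) : C1c 0 1 p -> is_wderiv p (derive1 p).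
Proof.
move=> pC q qC; have hd := C1c_derive_L2on pC.
rewrite -[RHS](Rintegral_primitive_C1c ltr01 hd qC)//.
apply: eq_Rintegral => x; rewrite inE/= in_itv/= => /andP[x0 x1].
rewrite (C1c_Rintegral_derive pC)// [p 0](C1c_out pC) ?ltxx// subr0.
by [].
Qed.

Section Trace.
Variables (f g : R -> R).
Hypotheses (hf : L2on I f) (hg : L2on I g) (fg : is_wderiv f g).
Let P x := \int[mu]_(t in `]0, x[) g t.

Let ig : mu.-integrable I (EFin \o g).
Proof. by apply: L2on_integrable => //; exact: itv_measure_lty. Qed.

Let cP : {within `[0, 1], continuous P}.
Proof. exact: primitive_continuous. Qed.

Let hP : L2on I P.
Proof. exact: within_L2on. Qed.

(** Subtracting the primitive of [g] from [f] leaves a function with zero weak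
    derivative. *)
Lemma H1_primitive : exists c, eqI f (fun x => c + P x).
Proof.
have hk : L2on I (fun x => f x - P x) by exact: L2onB.
have [p pC|c kc] := orthogonal_derive_cst (ltr01 : (0 : R) < 1) hk.
  rewrite -[LHS]/(ip _ (derive1 p)) ipB//; last exact: C1c_derive_L2on.
  rewrite [ip f _]fg// [ip P _]Rintegral_primitive_C1c// subrr.
  by [].
by exists c; apply: aeOnS kc => x _ /eqP; rewrite subr_eq => /eqP.
Qed.

Lemma crepE c : eqI f (fun x => c + P x) -> forall x, 0 <= x <= 1 -> trace f x = c + P x.
Proof.
move=> fc; have ch : {within `[0, 1], continuous (fun x => c + P x)}.
  apply/within_continuousP => x x01; apply: cvgD; first exact: cvg_cst.
  by move/within_continuousP : cP; exact.
have [] : {within `[0, 1], continuous (crep f)} /\ eqI f (crep f).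
  rewrite /crep; apply: (@xgetPex _ (fun=> 0)
    [set h : R -> R | {within `[0 : R, 1 : R], continuous h} /\ eqI f h]).
  by exists (fun x => c + P x).
move=> cc fcc; apply: ae_continuous_eq => //.
exact: eqI_trans (eqI_sym fcc) fc.
Qed.

Let ipP : intI P = ip g (fun x => 1 - x).
Proof.
have h1 x : I x -> `|1 : R| <= 1 by rewrite normr1.
have sw := @Rintegral_primitive_swap _ g (fun=> 1) 0 1 1 ig (measurable_cst _) h1.
transitivity (\int[mu]_(y in I) (1 * P y)).
  by apply: eq_Rintegral => y _; rewrite mul1r.
rewrite sw /ip /intI.
apply: eq_Rintegral => x; rewrite inE/= in_itv/= => /andP[x0 x1].
by rewrite Rintegral_cst// mul1r fine_itv_measure// ltW.
Qed.

Lemma intI_H1 c : eqI f (fun x => c + P x) -> intI f = c + ip g (fun x => 1 - x).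
Proof.
move=> fc; rewrite (intI_eqI _ _ fc).
- rewrite /intI RintegralD//; last 2 first.
  + by apply: L2on_integrable (itv_measure_lty _ _ _ _) (L2on_cst c).
  + by apply: L2on_integrable (itv_measure_lty _ _ _ _) hP.
  by rewrite Rintegral_cst// fine_itv_measure// subr0 mulr1 -ipP.
- exact: L2on_measurable.
- by apply: measurable_funD => //; exact: L2on_measurable.
Qed.

(** Both boundary formulas come from [f = c + P]: the mean of the primitive [P] is
    the integral of [g] against [1 - x], by Fubini. *)
Lemma trace0E : trace f 0 = intI f - ip g (fun x => 1 - x).
Proof.
have [c fc] := H1_primitive; rewrite (crepE fc) ?lexx ?ler01// (intI_H1 fc).
by rewrite /P set_itv_ge ?bnd_simp// Rintegral_set0; ring.
Qed.

Lemma trace1E : trace f 1 = intI f + ip g (fun x => x).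
Proof.
have [c fc] := H1_primitive; rewrite (crepE fc) ?lexx ?ler01// (intI_H1 fc).
rewrite -addrA; congr +%R; rewrite /P -/(intI g).
have -> : intI g = ip g (fun=> 1) by apply: eq_Rintegral => x _; rewrite mulr1.
rewrite /ip /intI -RintegralD//.
- by apply: eq_Rintegral => x _; ring.
- by apply: L2on_mul_integrable => //; apply: L2onB; [exact: L2on_cst|exact: L2on_id].
- by apply: L2on_mul_integrable => //; exact: L2on_id.
Qed.

End Trace.
End Sobolev.

(** * Bochner integrals *)

Section Bochner.
Context {R : realType}.
Local Notation mu := (@lebesgue_measure R).
Local Notation I := (`]0, 1[%classic : set R).
Implicit Types (h v : R -> R) (T c t : R).

(** The integral of an arbitrary nonnegative function is a supremum over simple
    minorants, hence monotone.  In the application [g] is the norm of the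
    difference of a function and a simple one. *)
Lemma ge0_le_integral_subset (D' D : set R) (f g : R -> \bar R) : D' `<=` D ->
  (forall t, D' t -> (0 <= f t)%E) -> (forall t, D t -> (0 <= g t)%E) ->
  (forall t, D' t -> (f t <= g t)%E) ->
  (\int[mu]_(t in D') f t <= \int[mu]_(t in D) g t)%E.
Proof.
move=> sub f0 g0 fg; rewrite integral_mkcond [leRHS]integral_mkcond.
have f0' t : (0 <= (f \_ D') t)%E by exact: erestrict_ge0.
have g0' t : (0 <= (g \_ D) t)%E by exact: erestrict_ge0.
rewrite !ge0_integralTE//; apply: le_ereal_sup => _ /= [s sf <-]; exists s => // t.
apply: le_trans (sf t) _; rewrite !patchE; case: ifPn => tD'.
  by rewrite mem_set; [apply: fg; exact: set_mem|apply: sub; exact: set_mem].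
by case: ifPn => // tD; apply: g0; exact: set_mem.
Qed.

Lemma ip_sum (n : nat) (c : 'I_n -> R) (F : 'I_n -> R -> R) v : L2on I v ->
  (forall i, L2on I (F i)) ->
  L2on I (\sum_(i < n) c i *: F i) /\
  ip (\sum_(i < n) c i *: F i) v = \sum_(i < n) c i * ip (F i) v.
Proof.
move=> hv hF; apply: (big_rec2 (fun (f : R -> R) x => L2on I f /\ ip f v = x)).
  split; first exact: (L2on_cst 0).
  by rewrite /ip /intI; under eq_Rintegral do rewrite mul0r; rewrite Rintegral_cst// mul0r.
move=> i x f _ [hf <-]; have hcF : L2on I (c i *: F i) by exact: L2onZ.
by split; [exact: L2onD|rewrite [LHS]ipD// [X in X + _]ipZ].
Qed.

Lemma Rintegral_indic_sum (D : set R) (n : nat) (c : 'I_n -> R) (A : 'I_n -> set R) :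
  measurable D -> (mu D < +oo)%E ->
  (forall i, measurable (A i)) -> (forall i, A i `<=` D) ->
  mu.-integrable D (EFin \o (fun t => \sum_(i < n) \1_(A i) t * c i)) /\
  \int[mu]_(t in D) (\sum_(i < n) \1_(A i) t * c i) =
  \sum_(i < n) fine (mu (A i)) * c i.
Proof.
move=> mD Doo mA AD.
have iA i : mu.-integrable D (EFin \o (\1_(A i) : R -> R)).
  apply: (@bounded_integrable _ _ _ 1) => //.
  by move=> x _; rewrite indicE; case: (_ \in _); rewrite ?normr1 ?normr0.
have E : (fun t => \sum_(i < n) \1_(A i) t * c i) =
    \sum_(i < n) (fun t => \1_(A i) t * c i) by rewrite fct_sumE.
rewrite E; apply: (big_rec2 (fun (f : R -> R) x =>
  mu.-integrable D (EFin \o f) /\ \int[mu]_(t in D) f t = x)).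
  split; first by exact: integrable0.
  by rewrite Rintegral_cst// mul0r.
move=> i x f _ [fi <-].
have iAc : mu.-integrable D (EFin \o (fun t => \1_(A i) t * c i)).
  have := integrable_scale (c i) mD (iA i).
  by apply: eq_integrable => // t _ /=; rewrite mulrC.
split.
  have := @integrableD _ _ _ mu D mD _ _ iAc fi.
  by apply: eq_integrable => // t _.
rewrite [LHS]RintegralD//; congr +%R.
rewrite RintegralZr//; congr *%R; rewrite /Rintegral integral_indic//.
  by rewrite setIidl//; exact: AD.
exact: mA.
Qed.

Lemma cvg_norm_bound (x : R ^nat) (l : R) (e : (\bar R) ^nat) (C : R) : 0 <= C ->
  (forall n, `|x n - l|%:E <= C%:E * e n)%E -> e @ \oo --> (0 : \bar R) -> x @ \oo --> l.
Proof.
move=> C0 xe /fine_cvgP[finE /= fe].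
apply/cvgrPdist_le => eps eps0.
have : C * fine (e n) @[n --> \oo] --> (0 : R).
  by rewrite -(mulr0 C); apply: cvgM; [exact: cvg_cst|exact: fe].
move/cvgr0Pnorm_le => /(_ _ eps0).
apply: filterS2 finE => n fn; rewrite distrC; apply: le_trans.
rewrite -lee_fin; apply: le_trans (xe n) _.
by rewrite -(fineK fn) -EFinM lee_fin ler_norm.
Qed.

(** A Bochner integral commutes with a continuous linear functional: this is
    clear for simple functions and passes to the limit by Cauchy-Schwarz.  The
    function [h] stands for a measurable version of [<F, v>]. *)
Lemma bochner_ip T (F : R -> R -> R) (w : R -> R) v h :
  is_bochner T L2I F w -> L2on I v ->
  mu.-integrable `]0, T[ (EFin \o h) -> aeOn `]0, T[ (fun t => h t = ip (F t) v) ->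
  \int[mu]_(t in `]0, T[) h t = ip w v.
Proof.
move=> [hw [s [[sok sae] s1 s2]]] hv ih hF.
have mD : measurable (`]0, T[%classic : set R) by [].
have Doo : (mu (`]0%R, T[%classic : set R) < +oo)%E by exact: itv_measure_lty.
have hsv n i : L2on I (sf_val (s := s n) i) by have [] := sok n i.
pose k n t := \sum_i \1_(sf_set (s := s n) i) t * ip (sf_val i) v.
have kE n t : L2on I (sf_eval (s n) t) /\ ip (sf_eval (s n) t) v = k n t.
  exact: ip_sum.
have jE n : L2on I (sf_int (s n)) /\
    ip (sf_int (s n)) v = \sum_i fine (mu (sf_set (s := s n) i)) * ip (sf_val i) v.
  exact: ip_sum.
have ik n := @Rintegral_indic_sum (`]0, T[%classic : set R) _  (fun i => ip (sf_val i) v)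
  (sf_set (s := s n)) mD Doo
  (fun i => let: And3 m _ _ := sok n i in m) (fun i => let: And3 _ m _ := sok n i in m).
have lim1 : \int[mu]_(t in `]0, T[) k n t @[n --> \oo] --> ip w v.
  under eq_fun => n do rewrite (ik n).2 -(jE n).2.
  apply/cvgrPdist_le => eps eps0.
  have : L2norm (sf_int (s n) - w) * L2norm v @[n --> \oo] --> (0 : R).
    by rewrite -(mul0r (L2norm v)); apply: cvgM; [exact: s2|exact: cvg_cst].
  move/cvgr0Pnorm_le => /(_ _ eps0).
  apply: filterS => n; rewrite distrC; apply: le_trans.
  rewrite -ipB//; last exact: (jE n).1.
  apply: le_trans (ip_le _ hv) (ler_norm _).
  by apply: L2onB => //; exact: (jE n).1.
suff lim2 : \int[mu]_(t in `]0, T[) k n t @[n --> \oo] --> \int[mu]_(t in `]0, T[) h t.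
  exact: (cvg_unique _ lim2 lim1).
pose C := L2norm v + 1.
have C0 : 0 < C by rewrite ltr_wpDl// L2norm_ge0.
apply: (cvg_norm_bound (ltW C0) _ s1) => n.
have ikn := (ik n).1.
have ikh : mu.-integrable `]0, T[ (EFin \o (fun t => k n t - h t)).
  have := @integrableB _ _ _ mu _ mD _ _ ikn ih.
  by apply: eq_integrable => // t _.
have mkh : measurable_fun `]0, T[ (fun t => k n t - h t).
  by have /integrableP[/measurable_EFinP] := ikh.
rewrite -RintegralB//.
apply: (@le_trans _ _ (\int[mu]_(t in `]0%R, T[) `|k n t - h t|%:E)%E).
  by rewrite EFin_normr_Rintegral//; apply: le_abse_integral => //; exact/measurable_EFinP.
(* The comparison with the norm is made off the null set N, where F has values
   in L^2; the constant C is positive so that it can be divided out. *)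
have [N [mN N0 HN]] := aeOnI sae hF.
have mDN : measurable (`]0, T[ `\` N : set R) by exact: measurableD.
have -> : (\int[mu]_(t in `]0%R, T[) `|k n t - h t|%:E =
    C%:E * \int[mu]_(t in `]0%R, T[ `\` N) (C^-1 * `|k n t - h t|)%:E)%E.
  rewrite [LHS](negligible_integral mN)//; last first.
    have := integrable_abse ikh; apply: eq_integrable => // t _ /=.
  under [in RHS]eq_integral do rewrite EFinM.
  rewrite ge0_integralZl_EFin ?invr_ge0 ?(ltW C0)//; last first.
    apply/measurable_EFinP; apply: measurableT_comp => //.
    by apply: measurable_funS mkh => //; exact: subDsetl.
  by rewrite muleA -EFinM mulfV ?gt_eqF// mul1e.
apply: lee_wpmul2l; first by rewrite lee_fin ltW.
apply: ge0_le_integral_subset => //.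
- by move=> t _; rewrite lee_fin mulr_ge0// invr_ge0 ltW.
- by move=> t _; rewrite lee_fin L2norm_ge0.
move=> t [tT /= Nt]; have [[hFt _] ht] : (L2on I (F t) /\
     L2norm (sf_eval (s n) t - F t) @[n --> \oo] --> (0 : R)) /\ h t = ip (F t) v.
  by apply: contrapT => H; apply: Nt; apply: HN => /(_ tT).
rewrite lee_fin mulrC ler_pdivrMr// ht -(kE n t).2 -ipB//; last exact: (kE n t).1.
apply: le_trans (ip_le _ hv) _; first by apply: L2onB => //; exact: (kE n t).1.
by rewrite ler_wpM2l ?L2norm_ge0// lerDl.
Qed.

End Bochner.

(** * Derivatives in time *)

Section TimeDerivative.
Context {R : realType}.
Local Notation mu := (@lebesgue_measure R).
Local Notation I := (`]0, 1[%classic : set R).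
Implicit Types (a d g h v : R -> R) (T c t : R) (F : R -> R -> R) (G : R -> R).

Lemma cvg_bound {U : Type} (D : set_system U) {FD : Filter D} (x y : U -> R) (l C : R) :
  (\forall s \near D, `|x s - l| <= C * y s) -> y s @[s --> D] --> (0 : R) ->
  x s @[s --> D] --> l.
Proof.
move=> xy y0; apply/cvgrPdist_le => e e0.
have : C * y s @[s --> D] --> (0 : R).
  by rewrite -(mulr0 C); apply: cvgM; [exact: cvg_cst|exact: y0].
move/cvgr0Pnorm_le => /(_ _ e0); apply: filterS2 xy => s xy /(le_trans (ler_norm _)).
by apply: le_trans; rewrite distrC.
Qed.

Lemma within_dnbhs_ex T t (P : R -> Prop) : 0 < T -> 0 <= t <= T ->
  (\forall s \near within `[0, T] t^', P s) -> exists s, P s.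
Proof.
move=> T0 /andP[t0 tT] [e /= e0 He].
have [tT'|Tt] := ltP t T.
  pose s := Num.min T (t + e / 2).
  have ts : t < s by rewrite lt_min tT' ltrDl divr_gt0.
  exists s; apply: He => /=.
  - rewrite ltr_distlC; apply/andP; split; first by rewrite (lt_trans _ ts)// ltrBlDr ltrDl.
    by rewrite gt_min; apply/orP; right; rewrite ltrD2l ltr_pdivrMr// ltr_pMr// ltr1n.
  - by rewrite gt_eqF.
  - by rewrite in_itv/= (le_trans t0 (ltW ts))/= ge_min lexx.
have tE : t = T by apply/eqP; rewrite eq_le tT Tt.
pose s := Num.max 0 (T - e / 2).
have st : s < T by rewrite gt_max T0 ltrBlDr ltrDl divr_gt0.
exists s; apply: He => /=.
- rewrite tE ltr_distlC; apply/andP; split; last by rewrite (lt_trans st)// ltrDl.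
  rewrite lt_max; apply/orP; right.
  by rewrite ltrD2l ltrN2 ltr_pdivrMr// ltr_pMr// ltr1n.
- by rewrite lt_eqF// (lt_le_trans st).
- by rewrite in_itv/= le_max lexx/= ltW.
Qed.

Lemma tderiv_scalarsP T a t c : is_tderiv T scalars a t c <->
  (s - t)^-1 * (a s - a t) @[s --> within `[0, T] t^'] --> c.
Proof.
split=> [[_ H]|/cvgrPdist_le H].
  apply: (cvg_bound (C := 1)) H.
  by apply: nearW => s; rewrite mul1r.
split=> //; apply/cvgr0Pnorm_le => e /H; apply: filterS => s.
by rewrite distrC /= normr_id.
Qed.

Lemma tderiv_scalars_unique T a t c c' : 0 < T -> 0 <= t <= T ->
  is_tderiv T scalars a t c -> is_tderiv T scalars a t c' -> c = c'.
Proof.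
move=> T0 tT /tderiv_scalarsP/cvgrPdist_lt H /tderiv_scalarsP/cvgrPdist_lt H'.
apply/eqP; rewrite -subr_eq0 -normr_le0 leNgt; apply/negP => cc'.
have e0 : 0 < `|c - c'| / 2 by rewrite divr_gt0.
have [s [Hs Hs']] := within_dnbhs_ex T0 tT (filterI (H _ e0) (H' _ e0)).
have := ler_distD ((s - t)^-1 * (a s - a t)) c c'.
by rewrite leNgt => /negP; apply; rewrite [ltRHS]splitr ltrD// distrC.
Qed.

Lemma tderiv_ip T F t G v : (forall s, 0 <= s <= T -> L2on I (F s)) -> L2on I v ->
  0 <= t <= T -> is_tderiv T L2I F t G ->
  is_tderiv T scalars (fun s => ip (F s) v) t (ip G v).
Proof.
move=> hF hv tT [hG H]; apply/tderiv_scalarsP; apply: (cvg_bound (C := L2norm v)) H.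
rewrite near_withinE; apply: nearW => s /=; rewrite in_itv/= => sT.
have hB : L2on I (F s - F t) by apply: L2onB; exact: hF.
rewrite -ipB//; [|exact: hF|exact: hF].
rewrite -[X in _ * X]/(ip (F s - F t) v) -ipZ// -ipB//; last exact: L2onZ.
rewrite mulrC; apply: ip_le => //.
by apply: L2onB => //; exact: L2onZ.
Qed.

(** Derivatives in [L^2] are compared through their pairings with test functions,
    where uniqueness is that of a limit of numbers. *)
Lemma tderiv_L2_unique T F t G G' : (forall s, 0 <= s <= T -> L2on I (F s)) ->
  0 < T -> 0 <= t <= T -> is_tderiv T L2I F t G -> is_tderiv T L2I F t G' -> eqI G G'.
Proof.
move=> hF T0 tT FG FG'; have hG := FG.1; have hG' := FG'.1.
have : eqI (fun x => G x - G' x) (fun=> 0).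
  apply: ip_C1c_eqI0 => [|p /C1c_L2on hp]; first exact: L2onB.
  rewrite ipB//; apply/eqP; rewrite subr_eq0; apply/eqP.
  by apply: (@tderiv_scalars_unique T (fun s => ip (F s) p) t) => //; exact: tderiv_ip.
by apply: aeOnS => x _ /eqP; rewrite subr_eq0 => /eqP.
Qed.

Lemma within_continuous_bound T a (N : R -> R -> R) (C : R) :
  (forall s t, 0 <= s <= T -> 0 <= t <= T -> `|a s - a t| <= C * N s t) ->
  (forall t, 0 <= t <= T -> N s t @[s --> within `[0, T] (nbhs t)] --> (0 : R)) ->
  {within `[0, T], continuous a}.
Proof.
move=> aN N0; apply/within_continuousP => t tT.
apply: (cvg_bound (C := C)) (N0 _ tT).
by rewrite near_withinE; apply: nearW => s /=; rewrite in_itv/= => sT; exact: aN.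
Qed.

Lemma tderiv_derive T a t c : 0 < t < T -> is_tderiv T scalars a t c ->
  derivable a t 1 /\ derive1 a t = c.
Proof.
move=> tT /tderiv_scalarsP/cvgrPdist_le H.
suff : is_derive t 1 a c by move=> [? <-]; rewrite derive1E.
apply: is_derive_cvg; apply/cvgrPdist_le => e /H [r /= r0 Hr].
have tT' : t \in `]0, T[ by rewrite in_itv.
have [r' /= r'0 Hr'] := near_in_itvoo tT'.
near=> k.
have k0 : k != 0 by near: k; exact: nbhs_dnbhs_neq.
have kr : `|k| < r by near: k; exact: dnbhs0_lt.
have kr' : `|k| < r' by near: k; exact: dnbhs0_lt.
have := Hr (k + t); rewrite /= opprD addrCA subrr addr0 normrN addrK; apply => //.
- by rewrite -subr_eq0 addrK.
- have := Hr' (k + t); rewrite /= opprD addrCA subrr addr0 normrN => /(_ kr').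
  by rewrite !in_itv/= => /andP[/ltW -> /ltW].
Unshelve. all: by end_near. Qed.

Lemma Rintegral_itv_cc_oo h (x y : R) : measurable_fun `]x, y[ h ->
  \int[mu]_(t in `[x, y]) h t = \int[mu]_(t in `]x, y[) h t.
Proof.
by move=> mh; rewrite /Rintegral (integral_itv_bndoo true false)//; exact/measurable_EFinP.
Qed.

Lemma tderiv_ibp T a d p : 0 < T -> {within `[0, T], continuous a} ->
  {within `[0, T], continuous d} ->
  (forall t, 0 <= t <= T -> is_tderiv T scalars a t (d t)) -> C1c 0 T p ->
  \int[mu]_(t in `]0, T[) (derive1 p t * a t) = - \int[mu]_(t in `]0, T[) (p t * d t).
Proof.
move=> T0 ca cd da pC.
have aE t : t \in `]0, T[ -> derivable a t 1 /\ derive1 a t = d t.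
  rewrite in_itv/= => /andP[t0 tT]; apply: (@tderiv_derive T); first by rewrite t0.
  by apply: da; rewrite !ltW.
have [dp cp _] := pC; have cpT := C1c_within pC; have cdpT := C1c_derive_within pC.
have /(continuous_within_itvP _ T0)[_ a0 aT] := ca.
have /(continuous_within_itvP _ T0)[_ p0 pT] := cpT.
have := @Rintegration_by_parts _ p a (derive1 p) d 0 T T0 cdpT _ _ cd _ _.
rewrite !(C1c_out pC (x := 0)) ?ltxx// !(C1c_out pC (x := T)) ?ltxx ?andbF//.
rewrite !mul0r subrr sub0r => ibp.
rewrite -!Rintegral_itv_cc_oo; last 2 first.
- by apply: measurable_funM; exact: within_measurable.
- by apply: measurable_funM; exact: within_measurable.
rewrite ibp ?opprK//.
- by split => // z _; exact: dp.
- by split => // z /aE[].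
- by move=> z /aE[].
Qed.

(** Pairing a distributional derivative with [v] gives the distributional
    derivative of the pairing.  If the latter is a C^1 function of time, its
    classical derivative is recovered by integration by parts in time. *)
Lemma weak_tderiv_ip T u ut v d b : 0 < T ->
  is_weak_tderiv T L2I u ut -> L2on I v ->
  (forall t, 0 <= t <= T -> L2on I (u t)) -> aeOn `]0, T[ (fun t => L2on I (ut t)) ->
  {within `[0, T], continuous (fun t => ip (u t) v)} ->
  {within `[0, T], continuous d} ->
  (forall t, 0 <= t <= T -> is_tderiv T scalars (fun s => ip (u s) v) t (d t)) ->
  mu.-integrable `]0, T[ (EFin \o b) -> aeOn `]0, T[ (fun t => ip (ut t) v = b t) ->
  aeOn `]0, T[ (fun t => d t = b t).
Proof.
move=> T0 wu hv hu hut ca cd da ib utb.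
have mD : measurable (`]0, T[%classic : set R) by [].
have id : mu.-integrable `]0, T[ (EFin \o d) by exact: within_integrable (ltW T0) cd.
have idb : mu.-integrable `]0, T[ (EFin \o (fun t => d t - b t)).
  have := @integrableB _ _ _ mu _ mD _ _ id ib.
  by apply: eq_integrable => // t _.
have : aeOn `]0, T[ (fun t => d t - b t = 0).
  apply: C1c_orthogonal_ae0 => // p pC.
  have cp := C1c_within pC; have cdp := C1c_derive_within pC.
  have imul h : mu.-integrable `]0, T[ (EFin \o h) ->
      mu.-integrable `]0, T[ (EFin \o (fun t => h t * p t)).
    move=> ih; have [M pM] := continuous_itv_bounded (ltW T0) cp.
    apply: (@integrable_mul_bounded _ _ _ _ M) => //; first exact: within_measurable.
    by move=> t /=; rewrite in_itv/= => /andP[/ltW t0 /ltW tT]; rewrite pM// t0.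
  have [w [Bw Bw']] := wu p pC; have hw := Bw.1.
  have E1 : \int[mu]_(t in `]0, T[) (derive1 p t * ip (u t) v) = ip w v.
    apply: (bochner_ip Bw hv).
    - apply: (within_integrable (ltW T0)); apply/within_continuousP => t tT.
      apply: cvgM; [move/within_continuousP: cdp|move/within_continuousP: ca]; exact.
    - apply: (@aeOnS _ _ (fun=> True)); last by exists set0; split => // x /=; apply.
      move=> t /=; rewrite in_itv/= => /andP[/ltW t0 /ltW tT] _.
      by rewrite -[RHS]/(ip (fun x => derive1 p t * u t x) v) ipZ//; apply: hu; rewrite t0.
  have E2 : \int[mu]_(t in `]0, T[) (b t * p t) = ip (- w) v.
    apply: (bochner_ip Bw' hv); first exact: imul.
    apply: aeOnS (aeOnI hut utb) => t _ [hutt <-].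
    by rewrite -[RHS]/(ip (fun x => p t * ut t x) v) ipZ// mulrC.
  under eq_Rintegral do rewrite mulrBl.
  rewrite RintegralB//; [|exact: imul|exact: imul].
  rewrite E2 (_ : ip (- w) v = - ip w v); last first.
    rewrite -[RHS]mulN1r -ipZ//; congr ip; apply/funext => x; rewrite mulN1r.
    by [].
  rewrite -E1 (tderiv_ibp T0 ca cd da pC) opprK.
  by under [X in _ - X]eq_Rintegral do rewrite mulrC; rewrite subrr.
by apply: aeOnS => t _ /eqP; rewrite subr_eq0 => /eqP.
Qed.

End TimeDerivative.

(** * Absolutely continuous functions of one variable *)

Section AbsolutelyContinuous.
Context {R : realType}.
Local Notation mu := (@lebesgue_measure R).
Implicit Types (y g : R -> R) (T a b c e t x z : R).

(** Otherwise the supremum of the points that are reached could be passed. *)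
Lemma real_induction a b (P : R -> Prop) : a <= b -> P a ->
  (forall t, a <= t <= b -> exists2 r, 0 < r & forall x z,
    a <= x <= t -> t <= z <= b -> t - r < x -> z < t + r -> P x -> P z) -> P b.
Proof.
move=> ab Pa step; pose S := [set x | a <= x <= b /\ P x].
have Sa : S a by split=> //; rewrite lexx.
have supS : has_sup S by split; [exists a|exists b => x [/andP[]]].
have aS : a <= sup S by exact: ub_le_sup supS.2 _ Sa.
have Sb : sup S <= b by apply: ge_sup => [|x [/andP[]]]; first by exists a.
have [|r r0 Pr] := step (sup S); first by rewrite aS.
have [x [/andP[ax xb] Px] Sx] := sup_adherent r0 supS.
have xS : x <= sup S by apply: ub_le_sup supS.2 _ _; split => //; rewrite ax.
have [SB|bS] := ltP (sup S) b; last first.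
  by apply: (Pr x b) => //; rewrite ?ax ?lexx ?andbT//; lra.
pose z := Num.min b (sup S + r / 2).
have Sz : sup S < z by rewrite lt_min SB ltrDl divr_gt0.
have zb : z <= b by rewrite ge_min lexx.
have Pz : P z.
  apply: (Pr x z) => //; rewrite ?ax//; first by rewrite (ltW Sz).
  by rewrite gt_min; apply/orP; right; lra.
have : z <= sup S.
  by apply: ub_le_sup supS.2 _ _; split => //; rewrite zb (le_trans aS (ltW Sz)).
by rewrite leNgt Sz.
Qed.

(** Absolute continuity for lists of intervals ordered from right to left, the
    form in which intervals are accumulated below. *)
Lemma abs_cont_seq T y e d : (forall (m : nat) (a b : 'I_m -> R),
      (forall i, [/\ 0 <= a i, a i <= b i & b i <= T]) ->
      trivIset setT (fun i => `]a i, b i[%classic) ->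
      \sum_(i < m) (b i - a i) < d ->
      \sum_(i < m) `|y (b i) - y (a i)| < e) ->
  forall l : seq (R * R), all (fun p => (0 <= p.1) && (p.1 <= p.2) && (p.2 <= T)) l ->
    pairwise (fun p q => q.2 <= p.1) l ->
    \sum_(p <- l) (p.2 - p.1) < d -> \sum_(p <- l) `|y p.2 - y p.1| < e.
Proof.
move=> H l lT ldisj; rewrite !(big_nth (0, 0)) !big_mkord; apply: H.
- move=> i; have /(all_nthP (0, 0)) := lT; move=> /(_ i (ltn_ord i)).
  by move=> /andP[/andP[]].
- move: ldisj => /(pairwiseP (0, 0)) ldisj.
  move=> i j _ _ [x [/=]]; rewrite !in_itv/= => /andP[x1 x2] /andP[x3 x4].
  have [ij|ji|ij] := ltngtP i j; last exact: val_inj.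
    have := ldisj _ _ (ltn_ord i) (ltn_ord j) ij.
    by rewrite leNgt => /negP; case; exact: lt_trans x1 x4.
  have := ldisj _ _ (ltn_ord j) (ltn_ord i) ji.
  by rewrite leNgt => /negP; case; exact: lt_trans x3 x2.
Qed.

Lemma tderiv_near T y t c e : is_tderiv T scalars y t c -> 0 < e ->
  exists2 r, 0 < r & forall s, 0 <= s <= T -> `|s - t| < r ->
    `|y s - y t - c * (s - t)| <= e * `|s - t|.
Proof.
move=> /tderiv_scalarsP/cvgrPdist_le H /H [r /= r0 Hr]; exists r => // s sT str.
have [->|st] := eqVneq s t; first by rewrite !subrr mulr0 subrr normr0 mulr0.
have := Hr s; rewrite /= distrC => /(_ str st); rewrite in_itv/= => /(_ sT).
have st0 : s - t != 0 by rewrite subr_eq0.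
rewrite -(ler_pM2r (_ : 0 < `|s - t|)) ?normr_gt0// -normrM.
rewrite mulrBl (mulrC (s - t)^-1) -mulrA mulVf// mulr1.
by rewrite [leLHS]distrC.
Qed.

(** The times without a derivative close to [c] lie in an open set [U] of measure
    below any given bound.  Moving from [a] to [b], steps around a good time are
    controlled by its derivative and steps around a bad time stay inside [U];
    the latter are recorded in a list whose total length is at most the measure
    of [U], so that absolute continuity bounds their total increment. *)
Lemma abs_cont_slope T y a b c e : abs_cont T scalars y ->
  0 <= a -> a <= b -> b <= T -> 0 <= e ->
  aeOn `]a, b[ (fun t => exists2 d, is_tderiv T scalars y t d & `|d - c| <= e) ->
  `|y b - y a - c * (b - a)| <= e * (b - a).
Proof.
move=> yac a0 ab bT e0 [N [mN N0 HN]].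
suff key eta : 0 < eta ->
    `|y b - y a - c * (b - a)| <= (e + eta) * (b - a) + (eta + `|c| * eta).
  apply/ler_addgt0Pr => eps eps0.
  (* k is the factor of eta in the bound of key. *)
  pose k := b - a + 1 + `|c|.
  have k0 : 0 < k by rewrite /k ltr_wpDr// ltr_wpDl// subr_ge0.
  apply: le_trans (key (eps / k) _) _; first by rewrite divr_gt0.
  have -> : (e + eps / k) * (b - a) + (eps / k + `|c| * (eps / k)) =
    e * (b - a) + eps / k * k by rewrite /k; ring.
  by rewrite divfK ?gt_eqF.
move=> eta0; have [d d0 Hd] := yac eta eta0.
pose dl := Num.min d eta.
have dl0 : 0 < dl by rewrite lt_min d0.
(* The end points are counted as bad: nothing is known there. *)
pose D := N `|` [set a; b].
have mD : measurable D.
  by apply: measurableU => //; apply: measurableU; exact: measurable_set1.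
have D0 : mu D = 0%E.
  rewrite measureU0//; first by apply: measurableU; exact: measurable_set1.
  by apply: countable_lebesgue_measure0; apply: finite_set_countable; exact: finite_set2.
have Doo : (mu D < +oo)%E by rewrite D0 ltry.
have [U [oU DU Ud]] := @lebesgue_regularity_outer _ D dl mD Doo dl0.
have mU : measurable U by exact: open_measurable.
have {}Ud : (mu U < dl%:E)%E.
  rewrite (_ : U = (U `\` D) `|` D); last by rewrite setUC setDUK.
  by rewrite measureU0//; exact: measurableD.
(* Q x: the increment from a to x is controlled up to the bad steps in l. *)
pose Q x := exists l : seq (R * R),
  [/\ all (fun p => (0 <= p.1) && (p.1 <= p.2) && (p.2 <= x)) l,
      pairwise (fun p q => q.2 <= p.1) l,
      ((\sum_(p <- l) (p.2 - p.1))%:E <= mu (U `&` `]a, x]))%E &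
      `|y x - y a - c * (x - a)| <= (e + eta) * (x - a) +
        \sum_(p <- l) `|y p.2 - y p.1 - c * (p.2 - p.1)|].
have : Q b.
  apply: (@real_induction a b Q) => //.
    by exists [::]; split => //; rewrite ?big_nil// !subrr !mulr0 subrr normr0 addr0.
  move=> t /andP[at_ tb].
  have mUx x : measurable (U `&` `]a, x]) by apply: measurableI.
  have sub x z : x <= z -> U `&` `]a, x] `<=` U `&` `]a, z].
    by move=> xz; apply: setIS; apply: subset_itvl; rewrite bnd_simp.
  (* A step inside U is added to the list. *)
  have [tU|tU] := pselect (U t).
    have [r /= r0 Hr] := oU t tU.
    exists r => // x z /andP[ax xt] /andP[tz zb] tx zt [l [l1 l2 l3 l4]].
    have xz := le_trans xt tz.
    exists ((x, z) :: l); split => /=.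
    - rewrite (le_trans a0 ax) xz lexx/=; apply: sub_all l1 => p /andP[/andP[-> ->]/=].
      by move=> /le_trans; apply.
    - by rewrite l2 andbT; apply: sub_all l1 => p /andP[_].
    - rewrite big_cons/= EFinD.
      have -> : U `&` `]a, z] = `]x, z]%classic `|` (U `&` `]a, x]).
        apply/seteqP; split => s /=; rewrite !in_itv/=.
          move=> [Us /andP[as_ sz]]; have [sx|xs] := leP s x; first by right; rewrite as_.
          by left; rewrite sz.
        move=> [/andP[xs sz]|[Us /andP[as_ sx]]]; last by rewrite as_ (le_trans sx xz).
        split; last by rewrite (le_lt_trans ax xs).
        by apply: Hr => /=; rewrite ltr_distlC; apply/andP; split; lra.
      rewrite measureU//; last first.
        rewrite -subset0 => s /= [] ; rewrite !in_itv/= => /andP[xs _] [_ /andP[_ sx]].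
        by rewrite leNgt xs in sx.
        exact: mUx.
      apply: leeD => //; rewrite [leRHS]lebesgue_measure_itv/= lte_fin.
      by case: ltP => // zx; rewrite lee_fin subr_le0.
    - rewrite big_cons/=; have -> : y z - y a - c * (z - a) =
        (y z - y x - c * (z - x)) + (y x - y a - c * (x - a)) by ring.
      apply: le_trans (ler_normD _ _) _; rewrite addrCA lerD2l.
      by apply: le_trans l4 _; rewrite lerD2r ler_wpM2l ?addr_ge0 ?(ltW eta0)// lerD2r.
  (* A step around a good time t leaves the list unchanged. *)
  have tab : t \in `]a, b[.
    rewrite in_itv/= !lt_neqAle at_ tb !andbT; apply/andP; split; apply/eqP => E;
      apply: tU; apply: DU; right; [left|right]; by [].
  have [dt ytd dtc] : exists2 d, is_tderiv T scalars y t d & `|d - c| <= e.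
    by apply: contrapT => H; apply: tU; apply: DU; left; apply: HN => /(_ tab).
  have [r r0 Hr] := tderiv_near ytd eta0.
  exists r => // x z /andP[ax xt] /andP[tz zb] tx zt [l [l1 l2 l3 l4]].
  have xz := le_trans xt tz.
  exists l; split => //.
  - apply: sub_all l1 => p /andP[/andP[-> ->]/=].
    by move=> /le_trans; apply.
  - apply: le_trans l3 _; apply: le_measure; rewrite ?inE;
      [exact: mUx|exact: mUx|exact: sub].
  have -> : y z - y a - c * (z - a) = (y x - y a - c * (x - a)) +
     ((y z - y t - dt * (z - t)) - (y x - y t - dt * (x - t)) + (dt - c) * (z - x)).
    by ring.
  apply: le_trans (ler_normD _ _) _.
  have Hz : `|y z - y t - dt * (z - t)| <= eta * (z - t).
    have zt0 : 0 <= z - t by rewrite subr_ge0.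
    have := Hr z; rewrite (ger0_norm zt0); apply.
      by rewrite (le_trans _ tz) ?(le_trans zb)// (le_trans a0).
    by lra.
  have Hx : `|y x - y t - dt * (x - t)| <= eta * (t - x).
    have xt0 : 0 <= t - x by rewrite subr_ge0.
    have := Hr x; rewrite (distrC x) (ger0_norm xt0); apply.
      by rewrite (le_trans a0 ax)/= (le_trans xt)// (le_trans tb).
    by lra.
  have Hc : `|(dt - c) * (z - x)| <= e * (z - x).
    by rewrite normrM ler_pM// ger0_norm// subr_ge0.
  have : `|(y z - y t - dt * (z - t)) - (y x - y t - dt * (x - t)) + (dt - c) * (z - x)|
      <= (e + eta) * (z - x).
    apply: le_trans (ler_normD _ _) _.
    apply: le_trans (lerD (le_trans (ler_normB _ _) (lerD Hz Hx)) Hc) _.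
    by rewrite le_eqVlt; apply/orP; left; apply/eqP; ring.
  move=> H; apply: le_trans (lerD l4 H) _.
  by rewrite le_eqVlt; apply/orP; left; apply/eqP; ring.
move=> [l [l1 l2 l3 l4]]; apply: le_trans l4 _; rewrite lerD2l.
have lsum : \sum_(p <- l) (p.2 - p.1) < dl.
  rewrite -lte_fin; apply: le_lt_trans l3 _; apply: le_lt_trans Ud.
  by apply: le_measure; rewrite ?inE//; apply: measurableI.
have ysum : \sum_(p <- l) `|y p.2 - y p.1| < eta.
  apply: (abs_cont_seq Hd) => //.
    by apply: sub_all l1 => p /andP[/andP[-> ->]/=] /le_trans; apply.
  by apply: lt_le_trans lsum _; rewrite ge_min lexx.
apply: (@le_trans _ _ (\sum_(p <- l) (`|y p.2 - y p.1| + `|c| * (p.2 - p.1)))).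
  rewrite big_seq [leRHS]big_seq; apply: ler_sum => p pl.
  apply: le_trans (ler_normB _ _) _; rewrite lerD2l normrM ler_wpM2l// ger0_norm//.
  by rewrite subr_ge0; move/allP: l1 => /(_ _ pl) /andP[/andP[_]].
rewrite big_split/= -mulr_sumr; apply: lerD; first exact: ltW.
by rewrite ler_wpM2l//; apply: le_trans (ltW lsum) _; rewrite ge_min lexx orbT.
Qed.

Lemma abs_cont_continuous T y : abs_cont T scalars y -> {within `[0, T], continuous y}.
Proof.
move=> yac; apply/within_continuousP => t tT; apply/cvgrPdist_lt => e e0.
have [d d0 Hd] := yac e e0.
rewrite near_withinE; near=> s => /=; rewrite in_itv/= => sT.
have std : `|s - t| < d.
  by rewrite distrC; near: s; exact: (@cvgr_dist_lt _ _ _ _ _ _ t).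
have := @abs_cont_seq T y e d Hd [:: (Num.min s t, Num.max s t)].
rewrite /= !big_cons !big_nil !addr0.
have [st|ts] := leP s t.
  move=> H; apply: H => //=.
    by rewrite st !andbT; case/andP: sT => ->; case/andP: tT => _ ->.
  by move: std; rewrite ler0_norm ?subr_le0// opprB.
move=> H; rewrite distrC; apply: H => //=.
  by rewrite (ltW ts) !andbT; case/andP: sT => _ ->; case/andP: tT => ->.
by move: std; rewrite gtr0_norm ?subr_gt0.
Unshelve. all: by end_near. Qed.

(** Near [t] the derivative is within [e] of [g t] almost everywhere, so
    [abs_cont_slope] with [c = g t] bounds the error of the difference quotient. *)
Lemma abs_cont_C1 T y g : abs_cont T scalars y -> {within `[0, T], continuous g} ->
  aeOn `]0, T[ (fun t => is_tderiv T scalars y t (g t)) ->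
  forall t, 0 <= t <= T -> is_tderiv T scalars y t (g t).
Proof.
move=> yac /within_continuousP cg yg t tT; apply/tderiv_scalarsP.
apply/cvgrPdist_le => e e0.
have /cvgrPdist_le/(_ _ e0) [r /= r0 Hr] := cg t tT.
rewrite near_withinE; near=> s => /=; rewrite in_itv/= => sT.
have st : s != t by near: s; exact: nbhs_dnbhs_neq.
have str : `|t - s| < r.
  by near: s; apply: nbhs_dnbhs; exists r.
have slope a b : 0 <= a -> a <= b -> b <= T ->
    (forall x, a < x < b -> `|t - x| < r) ->
    `|y b - y a - g t * (b - a)| <= e * (b - a).
  move=> a0 ab bT abr; apply: (abs_cont_slope yac) => //; first exact: ltW.
  have sub : `]a, b[ `<=` `]0, T[ by apply: subset_itv; rewrite bnd_simp.
  have yg' : aeOn `]a, b[ (fun x => is_tderiv T scalars y x (g x)).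
    case: yg => N [mN N0 HN]; exists N; split => //; apply: subset_trans HN.
    by apply: subsetC => x /= H /sub.
  apply: aeOnS yg' => x /=; rewrite in_itv/= => xab yx; exists (g x) => //.
  rewrite distrC; have /= := Hr x (abr _ xab); apply.
  by rewrite in_itv/=; case/andP: xab => *; apply/andP; split; lra.
have st0 : s - t != 0 by rewrite subr_eq0.
rewrite -(ler_pM2r (_ : 0 < `|s - t|)) ?normr_gt0// -normrM.
rewrite mulrBl (mulrC (s - t)^-1) -[X in _ - X]mulrA mulVf// mulr1 distrC.
case/andP: sT => s0 sT; case/andP: tT => t0 tT.
have [ls|ls] := leP s t.
  rewrite (distrC s) (ger0_norm (_ : 0 <= t - s)) ?subr_ge0//.
  have -> : y s - y t - g t * (s - t) = - (y t - y s - g t * (t - s)) by ring.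
  rewrite normrN; apply: slope => // x /andP[sx xt].
  by rewrite ger0_norm ?subr_ge0 ?(ltW xt)//; move: str; rewrite ger0_norm ?subr_ge0//; lra.
rewrite (ger0_norm (_ : 0 <= s - t)) ?subr_ge0 ?(ltW ls)//.
apply: slope => //; first exact: ltW.
move=> x /andP[tx xs]; rewrite distrC ger0_norm ?subr_ge0 ?(ltW tx)//.
by move: str; rewrite distrC ger0_norm ?subr_ge0 ?(ltW ls)//; lra.
Unshelve. all: by end_near. Qed.

End AbsolutelyContinuous.

(** * Boundary values and pairings of functions of time *)

Section SobolevTime.
Context {R : realType}.
Local Notation I := (`]0, 1[%classic : set R).
Implicit Types (f g h p v q : R -> R) (T t c x : R) (F : R -> R -> R).

Lemma trace_continuous f x : {within `[0, 1], continuous f} -> 0 <= x <= 1 ->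
  trace f x = f x.
Proof.
move=> cf; have [] : {within `[0, 1], continuous (crep f)} /\ eqI f (crep f).
  rewrite /crep; apply: (@xgetPex _ (fun=> 0)
    [set h : R -> R | {within `[0 : R, 1 : R], continuous h} /\ eqI f h]).
  by exists f; split => //; exact: eqI_refl.
by move=> cc fcc; apply: ae_continuous_eq => //; exact: eqI_sym.
Qed.

Lemma ip1 f : ip f (fun=> 1) = intI f.
Proof. by apply: eq_Rintegral => x _; rewrite mulr1. Qed.

Lemma trace1_ip f g : L2on I f -> L2on I g -> is_wderiv f g ->
  ip f (fun=> 1) = trace f 1 - ip g (fun x => x).
Proof. by move=> hf hg fg; rewrite (trace1E hf hg fg) addrK ip1. Qed.

Lemma trace_diff f g : L2on I f -> L2on I g -> is_wderiv f g ->
  trace f 1 - trace f 0 = intI g.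
Proof.
move=> hf hg fg; rewrite (trace1E hf hg fg) (trace0E hf hg fg).
transitivity (ip g (fun x => x) + ip g (fun x => 1 - x)); first by ring.
rewrite /ip /intI -RintegralD//.
- by apply: eq_Rintegral => x _; ring.
- by apply: L2on_mul_integrable => //; exact: L2on_id.
- by apply: L2on_mul_integrable => //; apply: L2onB; [exact: L2on_cst|exact: L2on_id].
Qed.

(** The functional [f |-> <f, 1> + <f', x>] is the boundary value at 1.  It is
    bounded on [H^1] and vanishes on test functions, hence on their closure. *)
Lemma H10_ip1 f : H10 f -> ip f (fun=> 1) = - ip (wderiv f) (fun x => x).
Proof.
move=> [Hf fp]; have hf := inH_L2on Hf; have [fw Hw] := inHS_wderiv Hf.
have hw := inH_L2on Hw; have h1 := @L2on_cst R 1; have hid := @L2on_id R.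
apply/eqP; rewrite -subr_eq0 opprK -normr_le0; apply/ler_addgt0Pr => e e0.
rewrite add0r; pose C := L2norm (fun=> 1 : R) + L2norm (fun x : R => x) + 1.
have C0 : 0 < C by rewrite ltr_wpDl// addr_ge0// L2norm_ge0.
have [p pC pe] := fp _ (divr_gt0 e0 C0).
have hp := C1c_L2on pC; have hp' := C1c_derive_L2on pC; have pp' := C1c_is_wderiv pC.
have p0 : ip p (fun=> 1) + ip (derive1 p) (fun x => x) = 0.
  rewrite (trace1_ip hp hp' pp') addrNK trace_continuous ?lexx ?ler01//.
    by rewrite (C1c_out pC)// ltxx andbF.
  exact: C1c_within pC.
have Hp : inH 1 p by split => //; exists (derive1 p).
have HB : inH 1 (f - p) by exact: inHB.
have [Bw HBw] := inHS_wderiv HB.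
have wE : eqI (wderiv (f - p)) (fun x => wderiv f x - derive1 p x).
  apply: is_wderiv_unique Bw _; [exact: inH_L2on HBw|exact: L2onB|].
  exact: is_wderivB.
have -> : ip f (fun=> 1) + ip (wderiv f) (fun x => x) =
    ip (f - p) (fun=> 1) + ip (wderiv (f - p)) (fun x => x).
  rewrite (ip_eqI (inH_L2on HBw) _ hid wE); last exact: L2onB.
  rewrite [ip (f - p) _]ipB// ipB// -[LHS]subr0 -[X in _ - X]p0; ring.
apply: le_trans (ler_normD _ _) _.
have n0 := @Hnorm_ge R 1 0 (f - p) isT; have n1 := @Hnorm_ge R 1 1 (f - p) isT.
have H0 : 0 <= Hnorm 1 (f - p) by exact: le_trans (L2norm_ge0 _) n0.
apply: (@le_trans _ _ (Hnorm 1 (f - p) * C)).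
  rewrite /C mulrDr mulrDr -[leLHS]addr0; apply: lerD; last by rewrite mulr1.
  apply: lerD.
    apply: le_trans (ip_le (inH_L2on HB) h1) _.
    by rewrite ler_wpM2r ?L2norm_ge0.
  apply: le_trans (ip_le (inH_L2on HBw) hid) _.
  by rewrite ler_wpM2r ?L2norm_ge0.
by rewrite -ler_pdivlMr// ltW.
Qed.

Lemma Hnorm_ip_continuous T k j F v : (j <= k)%N -> L2on I v ->
  (forall t, 0 <= t <= T -> inH k (F t)) ->
  (forall t, 0 <= t <= T ->
     Hnorm k (F s - F t) @[s --> within `[0, T] (nbhs t)] --> (0 : R)) ->
  {within `[0, T], continuous (fun t => ip (wderivn j (F t)) v)}.
Proof.
move=> jk hv HF cF; apply: (within_continuous_bound (C := L2norm v)) cF.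
move=> s t /HF Hs /HF Ht.
have hs := inH_wderivn_L2on jk Hs; have ht := inH_wderivn_L2on jk Ht.
have hst := inH_wderivn_L2on jk (inHB Hs Ht).
rewrite -ipB// -(ip_eqI hst _ hv (wderivnB jk Hs Ht)); last exact: L2onB.
apply: le_trans (ip_le hst hv) _; rewrite mulrC ler_wpM2l ?L2norm_ge0//.
exact: Hnorm_ge.
Qed.

Lemma L2norm_ip_continuous T F v : L2on I v -> (forall t, 0 <= t <= T -> L2on I (F t)) ->
  (forall t, 0 <= t <= T ->
     L2norm (F s - F t) @[s --> within `[0, T] (nbhs t)] --> (0 : R)) ->
  {within `[0, T], continuous (fun t => ip (F t) v)}.
Proof.
move=> hv hF cF; apply: (within_continuous_bound (C := L2norm v)) cF.
move=> s t /hF hs /hF ht; rewrite -ipB// mulrC; apply: ip_le => //.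
exact: L2onB.
Qed.

Lemma Hnorm_eqI k f g : inH k f -> inH k g -> eqI f g -> Hnorm k f = Hnorm k g.
Proof.
move=> Hf Hg fg; congr Num.sqrt; apply: eq_bigr => j _; congr (_ ^+ 2).
have jk : (j <= k)%N by rewrite -ltnS.
apply: L2norm_eqI; [exact: inH_wderivn_L2on Hf|exact: inH_wderivn_L2on Hg|].
by apply: wderivn_eqI => //; [exact: inH_L2on Hf|exact: inH_L2on Hg].
Qed.

Lemma tderiv_Hnorm_L2 T k F t (G : R -> R) (X : nspace R (R -> R)) :
  (forall f, X f -> inH k f) -> nrm X = Hnorm k ->
  is_tderiv T X F t G -> is_tderiv T L2I F t G.
Proof.
move=> Xk nX [/Xk Hg]; rewrite nX => H; split; first exact: inH_L2on Hg.
apply: (cvg_bound (C := 1)) H; apply: nearW => s.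
by rewrite subr0 mul1r ger0_norm ?L2norm_ge0//; exact: (@Hnorm_ge _ k 0).
Qed.

Lemma tderiv_scalars_scale T a a' t c k : 0 <= t <= T ->
  (forall s, 0 <= s <= T -> a s = k * a' s) ->
  is_tderiv T scalars a' t c -> is_tderiv T scalars a t (k * c).
Proof.
move=> tT aE /tderiv_scalarsP H; apply/tderiv_scalarsP.
have : k * ((s - t)^-1 * (a' s - a' t)) @[s --> within `[0, T] t^'] --> k * c.
  by apply: cvgM; [exact: cvg_cst|exact: H].
apply: cvg_trans; apply: near_eq_cvg; rewrite near_withinE; apply: nearW => s /=.
by rewrite in_itv/= => sT; rewrite !aE//; ring.
Qed.

Lemma withinD T f g : {within `[0, T], continuous f} -> {within `[0, T], continuous g} ->
  {within `[0, T], continuous (fun t => f t + g t)}.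
Proof.
move=> /within_continuousP cf /within_continuousP cg; apply/within_continuousP => t tT.
by apply: cvgD; [exact: cf|exact: cg].
Qed.

Lemma withinZ T f c : {within `[0, T], continuous f} ->
  {within `[0, T], continuous (fun t => c * f t)}.
Proof.
move=> /within_continuousP cf; apply/within_continuousP => t tT.
by apply: cvgM; [exact: cvg_cst|exact: cf].
Qed.

Lemma withinB T f g : {within `[0, T], continuous f} -> {within `[0, T], continuous g} ->
  {within `[0, T], continuous (fun t => f t - g t)}.
Proof.
move=> /within_continuousP cf /within_continuousP cg; apply/within_continuousP => t tT.
by apply: cvgB; [exact: cf|exact: cg].
Qed.

End SobolevTime.

(** * The strong equations *)

(* From here on only the characteristic properties of weak derivatives and traces
   matter, not the choice of representatives behind them. *)
Local Opaque wderiv trace.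

Section Strong.
Context {R : realType}.
Local Notation leb := (@lebesgue_measure R).
Local Notation I := (`]0, 1[%classic : set R).
Implicit Types (t s x theta : R) (q v : R -> R).
(* phit and phitt are the first two time derivatives of phi; u and ut are the
   primitive of phit and its weak time derivative. *)
Variables (sigma mu kappa T : R) (f : R -> R) (phi phit phitt u ut : R -> R -> R).
Hypotheses (T0 : 0 < T) (hf : L2on `]0, T[ f).
Hypotheses
  (Hphi : forall t, 0 <= t <= T -> inH 4 (phi t))
  (phi_cont : forall t, 0 <= t <= T ->
     Hnorm 4 (phi s - phi t) @[s --> within `[0, T] (nbhs t)] --> (0 : R))
  (phix0 : forall t, 0 <= t <= T -> trace (wderiv (phi t)) 0 = 0)
  (phix1 : forall t, 0 <= t <= T -> trace (wderiv (phi t)) 1 = 0).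
Hypotheses
  (Hphit : forall t, 0 <= t <= T -> inH 2 (phit t))
  (phit_cont : forall t, 0 <= t <= T ->
     Hnorm 2 (phit s - phit t) @[s --> within `[0, T] (nbhs t)] --> (0 : R))
  (phitx0 : forall t, 0 <= t <= T -> trace (wderiv (phit t)) 0 = 0)
  (phitx1 : forall t, 0 <= t <= T -> trace (wderiv (phit t)) 1 = 0)
  (phit_mean : forall t, 0 <= t <= T -> intI (phit t) = 0).
Hypotheses
  (hphitt : forall t, 0 <= t <= T -> L2on I (phitt t))
  (phitt_cont : forall t, 0 <= t <= T ->
     L2norm (phitt s - phitt t) @[s --> within `[0, T] (nbhs t)] --> (0 : R))
  (phit_deriv : forall t, 0 <= t <= T -> is_tderiv T L2I phit t (phitt t)).
Hypotheses
  (Hu : forall t, 0 <= t <= T -> H10 (u t))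
  (ux : forall t, 0 <= t <= T -> eqI (wderiv (u t)) (phit t))
  (u_deriv : is_weak_tderiv T L2I u ut)
  (hut : aeOn `]0, T[ (fun t => L2on I (ut t)))
  (ut_eq : aeOn `]0, T[ (fun t => eqI (ut t) (fun x =>
     wderiv (phi t) x - sigma * wderivn 3 (phi t) x
     + mu * wderivn 2 (u t) x - kappa * u t x - f t))).

Let rhs t x := wderivn 2 (phi t) x - sigma * wderivn 4 (phi t) x
  + mu * wderivn 2 (phit t) x - kappa * phit t x.

Let flux t := trace (wderivn 3 (phi t)) 1.

Lemma L2on_comb a b c d : L2on I a -> L2on I b -> L2on I c -> L2on I d ->
  L2on I (fun x => a x - sigma * b x + mu * c x - kappa * d x).
Proof.
move=> ha hb hc hd; apply: L2onB; last exact: L2onZ.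
by apply: L2onD; [apply: L2onB => //|]; exact: L2onZ.
Qed.

Lemma ip_comb a b c d v : L2on I a -> L2on I b -> L2on I c -> L2on I d -> L2on I v ->
  ip (fun x => a x - sigma * b x + mu * c x - kappa * d x) v =
  ip a v - sigma * ip b v + mu * ip c v - kappa * ip d v.
Proof.
move=> ha hb hc hd hv; have hsb := L2onZ sigma hb; have hmc := L2onZ mu hc.
have hkd := L2onZ kappa hd; have hab := L2onB ha hsb; have habc := L2onD hab hmc.
by rewrite (ipB habc hkd hv) (ipD hab hmc hv) (ipB ha hsb hv) !ipZ.
Qed.

Let hphi j t : (j <= 4)%N -> 0 <= t <= T -> L2on I (wderivn j (phi t)).
Proof. by move=> j4 /Hphi; exact: inH_wderivn_L2on. Qed.

Let hphit j t : (j <= 2)%N -> 0 <= t <= T -> L2on I (wderivn j (phit t)).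
Proof. by move=> j2 /Hphit; exact: inH_wderivn_L2on. Qed.

Let hu t : 0 <= t <= T -> L2on I (u t).
Proof. by move=> /Hu[/inH_L2on]. Qed.

Let hux t : 0 <= t <= T -> L2on I (wderiv (u t)).
Proof. by move=> /Hu[/inHS_wderiv[_ /inH_L2on]]. Qed.

Let uxx t : 0 <= t <= T -> wderivn 2 (u t) = wderiv (phit t).
Proof.
move=> tT; rewrite wderivnS /=; apply: wderiv_eqI; [exact: hux| |exact: ux].
exact: (hphit (j := 0)).
Qed.

Let hrhs t : 0 <= t <= T -> L2on I (rhs t).
Proof.
move=> tT; apply: L2on_comb; [exact: hphi|exact: hphi|exact: hphit|].
exact: (hphit (j := 0)).
Qed.

Let ip_rhs t v : 0 <= t <= T -> L2on I v -> ip (rhs t) v =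
  ip (wderivn 2 (phi t)) v - sigma * ip (wderivn 4 (phi t)) v
  + mu * ip (wderivn 2 (phit t)) v - kappa * ip (wderivn 0 (phit t)) v.
Proof.
move=> tT hv; apply: ip_comb => //; [exact: hphi|exact: hphi|exact: hphit|].
exact: (hphit (j := 0)).
Qed.

Let rhs_cont v : L2on I v -> {within `[0, T], continuous (fun t => ip (rhs t) v)}.
Proof.
move=> hv.
have cphi j : (j <= 4)%N -> {within `[0, T], continuous (fun t => ip (wderivn j (phi t)) v)}.
  by move=> j4; exact: Hnorm_ip_continuous phi_cont.
have cphit j : (j <= 2)%N -> {within `[0, T], continuous (fun t => ip (wderivn j (phit t)) v)}.
  by move=> j4; exact: Hnorm_ip_continuous phit_cont.
have /within_continuousP H : {within `[0, T], continuous (fun t =>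
  ip (wderivn 2 (phi t)) v - sigma * ip (wderivn 4 (phi t)) v
  + mu * ip (wderivn 2 (phit t)) v - kappa * ip (wderivn 0 (phit t)) v)}.
  apply: withinB; last by apply: withinZ; exact: cphit.
  apply: withinD; last by apply: withinZ; exact: cphit.
  by apply: withinB; [|apply: withinZ]; exact: cphi.
apply/within_continuousP => t tT; rewrite ip_rhs//.
apply: cvg_trans (H t tT); apply: near_eq_cvg; rewrite near_withinE; apply: nearW => s /=.
by rewrite in_itv/= => sT; rewrite ip_rhs.
Qed.

Let phitt_ip_cont v : L2on I v -> {within `[0, T], continuous (fun t => ip (phitt t) v)}.
Proof. by move=> hv; exact: L2norm_ip_continuous phitt_cont. Qed.

Let fluxE t : 0 <= t <= T -> flux t =
  ip (wderivn 3 (phi t)) (fun=> 1) + ip (wderivn 4 (phi t)) (fun x => x).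
Proof.
move=> tT; have E := trace1_ip (hphi (j := 3) isT tT) (hphi (j := 4) isT tT)
  (inH_is_wderivn (k := 4) (j := 3) isT (Hphi tT)).
by apply/eqP; rewrite -subr_eq eq_sym; apply/eqP; exact: E.
Qed.

Lemma flux_continuous : {within `[0, T], continuous flux}.
Proof.
have /within_continuousP H : {within `[0, T], continuous (fun t =>
  ip (wderivn 3 (phi t)) (fun=> 1) + ip (wderivn 4 (phi t)) (fun x => x))}.
  apply: withinD.
    by apply: (Hnorm_ip_continuous _ _ Hphi phi_cont) => //; exact: L2on_cst.
  by apply: (Hnorm_ip_continuous _ _ Hphi phi_cont) => //; exact: L2on_id.
apply/within_continuousP => t tT; rewrite fluxE//.
apply: cvg_trans (H t tT); apply: near_eq_cvg; rewrite near_withinE; apply: nearW => s /=.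
by rewrite in_itv/= => sT; rewrite fluxE.
Qed.

(** The integrations by parts of [tested_equation], once every pairing has been
    replaced by a number. *)
Lemma tested_arith (X A1 A3 B1 U a2 a4 b2 g r tr th ft iv : R) :
  X = A1 - sigma * A3 + mu * B1 - kappa * U - ft * iv ->
  A1 = th * 0 - a2 -> A3 = th * tr - a4 -> B1 = th * 0 - b2 -> U = -1 * g ->
  r = a2 - sigma * a4 + mu * b2 - kappa * g ->
  X = - r - th * sigma * tr - iv * ft.
Proof. by move=> -> -> -> -> -> ->; ring. Qed.

(** Here [q] plays the role of a primitive of [v], and [theta] records whether
    integration by parts against [v] leaves a boundary term at [x = 1].  Among
    the functions involved only [phi_xxx] can have a nonzero value there. *)
Lemma tested_equation v q theta : L2on I v -> L2on I q ->
  (forall h g, L2on I h -> L2on I g -> is_wderiv h g ->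
     ip h v = theta * trace h 1 - ip g q) ->
  (forall t, 0 <= t <= T -> ip (u t) v = - ip (wderiv (u t)) q) ->
  aeOn `]0, T[ (fun t =>
    ip (phitt t) q = ip (rhs t) q + theta * sigma * flux t + f t * intI v).
Proof.
move=> hv hq parts uparts.
pose b t := - ip (rhs t) q - theta * sigma * flux t - intI v * f t.
have uv t : 0 <= t <= T -> ip (u t) v = - 1 * ip (phit t) q.
  move=> tT; rewrite uparts// mulN1r; congr -%R; apply: ip_eqI => //.
  - exact: hux.
  - exact: (hphit (j := 0)).
  - exact: ux.
have cu : {within `[0, T], continuous (fun t => ip (u t) v)}.
  have /within_continuousP H := @withinZ R T _ (-1)
    (Hnorm_ip_continuous (j := 0) isT hq Hphit phit_cont).
  apply/within_continuousP => t tT; rewrite uv//.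
  apply: cvg_trans (H t tT); apply: near_eq_cvg; rewrite near_withinE; apply: nearW => s /=.
  by rewrite in_itv/= => sT; rewrite uv.
have du t : 0 <= t <= T ->
    is_tderiv T scalars (fun s => ip (u s) v) t (-1 * ip (phitt t) q).
  move=> tT; apply: (tderiv_scalars_scale tT uv); apply: tderiv_ip => //.
    by move=> s sT; exact: (hphit (j := 0)).
  exact: phit_deriv.
have ib : leb.-integrable `]0, T[ (EFin \o b).
  have ic : leb.-integrable `]0, T[ (EFin \o
      (fun t => -1 * ip (rhs t) q - theta * sigma * flux t)).
    apply: (within_integrable (ltW T0)); apply: withinB; apply: withinZ.
      exact: rhs_cont.
    exact: flux_continuous.
  have if_ : leb.-integrable `]0, T[ (EFin \o (fun t => intI v * f t)).
    by apply: integrable_scale => //; apply: L2on_integrable hf => //; exact: itv_measure_lty.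
  have := @integrableB _ _ _ leb `]0, T[%classic (measurable_itv _) _ _ ic if_.
  by apply: eq_integrable => // t _ /=; rewrite mulN1r.
have utv : aeOn `]0, T[ (fun t => ip (ut t) v = b t).
  apply: aeOnS (aeOnI hut ut_eq) => t; rewrite /= in_itv/= => t0T [hutt utE].
  have tT : 0 <= t <= T by case/andP: t0T => /ltW -> /ltW.
  have h1 : L2on I (wderiv (phi t)) by exact: (hphi (j := 1)).
  have h2 : L2on I (wderivn 2 (u t)) by rewrite uxx//; exact: (hphit (j := 1)).
  have hc := L2on_comb h1 (hphi (j := 3) isT tT) h2 (hu tT).
  have hcst := @L2on_cst R (f t).
  have F : ip (fun=> f t) v = f t * intI v.
    rewrite -[X in _ * X]ip1 /ip /intI -RintegralZl//.
      by apply: eq_Rintegral => x _; rewrite mulr1.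
    by apply: L2on_mul_integrable => //; exact: L2on_cst.
  have E := etrans (ip_eqI hutt (L2onB hc hcst) hv utE) (etrans (ipB hc hcst hv)
    (f_equal2 (fun x y => x - y) (ip_comb h1 (hphi (j := 3) isT tT) h2 (hu tT) hv) F)).
  have P1 := parts _ _ h1 (hphi (j := 2) isT tT)
    (inH_is_wderivn (k := 4) (j := 1) isT (Hphi tT)).
  have P3 := parts _ _ (hphi (j := 3) isT tT) (hphi (j := 4) isT tT)
    (inH_is_wderivn (k := 4) (j := 3) isT (Hphi tT)).
  have P2 := parts _ _ (hphit (j := 1) isT tT) (hphit (j := 2) isT tT)
    (inH_is_wderivn (k := 2) (j := 1) isT (Hphit tT)).
  rewrite [trace _ _]phix1// in P1; rewrite [trace _ _]phitx1// in P2.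
  rewrite uxx// in E.
  exact: (tested_arith E P1 P3 P2 (uv t tT) (ip_rhs tT hq)).
have := weak_tderiv_ip T0 u_deriv hv hu hut cu _ du ib utv.
move=> /(_ (@withinZ R T _ (-1) (phitt_ip_cont hq))); apply: aeOnS => t _.
rewrite /b => H; have {}H := congr1 -%R H; rewrite mulN1r opprK in H.
by rewrite H; ring.
Qed.

(** Tests with compact support remove both the boundary term and the force. *)
Lemma strong_equation t : 0 <= t <= T -> eqI (phitt t) (rhs t).
Proof.
move=> tT; have : eqI (fun x => phitt t x - rhs t x) (fun=> 0).
  apply: ip_C1c_eqI0 => [|q qC]; first by apply: L2onB; [exact: hphitt|exact: hrhs].
  have hq := C1c_L2on qC; have hq' := C1c_derive_L2on qC.
  rewrite ipB//; [|exact: hphitt|exact: hrhs].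
  apply/eqP; rewrite subr_eq0; apply/eqP.
  apply: (@ae_continuous_eq R (fun t => ip (phitt t) q) (fun t => ip (rhs t) q) 0 T) => //.
  - exact: phitt_ip_cont.
  - exact: rhs_cont.
  have q'0 : intI (derive1 q) = 0.
    rewrite /intI (C1c_Rintegral_derive qC)// !(C1c_out qC) ?subrr//.
      by rewrite ltxx.
    by rewrite ltxx andbF.
  have parts h g : L2on I h -> L2on I g -> is_wderiv h g ->
      ip h (derive1 q) = 0 * trace h 1 - ip g q.
    by move=> _ _ hg; rewrite mul0r sub0r; exact: hg.
  have uparts s : 0 <= s <= T -> ip (u s) (derive1 q) = - ip (wderiv (u s)) q.
    by move=> /Hu[/inHS_wderiv[uw _] _]; exact: uw.
  apply: aeOnS (tested_equation hq' hq parts uparts) => s _ ->.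
  by rewrite !mul0r q'0 mulr0 !addr0.
by apply: aeOnS => x _ /eqP; rewrite subr_eq0 => /eqP.
Qed.

(** The test [q = x] with [v = 1]: the equation cancels, and the boundary term
    balances the force. *)
Lemma boundary_force : aeOn `]0, T[ (fun t => - sigma * flux t = f t).
Proof.
have h1 := @L2on_cst R 1; have hid := @L2on_id R.
have parts h g : L2on I h -> L2on I g -> is_wderiv h g ->
    ip h (fun=> 1) = 1 * trace h 1 - ip g (fun x => x).
  by move=> hh hg hgh; rewrite mul1r; exact: trace1_ip.
have uparts s : 0 <= s <= T -> ip (u s) (fun=> 1) = - ip (wderiv (u s)) (fun x => x).
  by move=> /Hu; exact: H10_ip1.
have i1 : intI (fun=> 1 : R) = 1.
  by rewrite /intI Rintegral_cst// fine_itv_measure// subr0 mulr1.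
apply: aeOnS (tested_equation h1 hid parts uparts) => t; rewrite /= in_itv/= => /andP[t0 tT].
have t0T : 0 <= t <= T by rewrite !ltW.
rewrite (ip_eqI (hphitt t0T) (hrhs t0T) hid (strong_equation t0T)) i1.
by move=> /eqP; rewrite -addrA -subr_eq0 opprD addNKr; move/eqP; lra.
Qed.

Lemma phitt_mean t : 0 <= t <= T -> intI (phitt t) = 0.
Proof.
move=> tT; rewrite -ip1.
have H : is_tderiv T scalars (fun s => ip (phit s) (fun=> 1)) t (ip (phitt t) (fun=> 1)).
  apply: tderiv_ip => //; [|exact: L2on_cst|exact: phit_deriv].
  by move=> s sT; exact: (hphit (j := 0)).
apply: (tderiv_scalars_unique T0 tT H); rewrite -[X in is_tderiv _ _ _ _ X](mul0r 0).
apply: (@tderiv_scalars_scale _ _ _ (fun=> 0)) => //.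
  by move=> s sT; rewrite ip1 phit_mean// mul0r.
apply/tderiv_scalarsP; under eq_fun do rewrite subrr mulr0.
exact: cvg_cst.
Qed.

Lemma flux_arith (X r a2 a4 b2 g : R) : X = r ->
  r = a2 - sigma * a4 + mu * b2 - kappa * g ->
  X = 0 -> a2 = 0 -> b2 = 0 -> g = 0 -> sigma != 0 -> a4 = 0.
Proof.
move=> -> -> H a0 b0 g0 s0; move: H; rewrite a0 b0 g0 !mulr0 subr0 addr0 sub0r => /eqP.
by rewrite oppr_eq0 mulf_eq0 (negbTE s0) => /eqP.
Qed.

(** The mean of the equation over [(0, 1)] reduces to [sigma] times the mean of
    [phi_xxxx], which is the difference of the two boundary values. *)
Lemma flux_balance t : 0 <= t <= T -> sigma != 0 -> trace (wderivn 3 (phi t)) 0 = flux t.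
Proof.
move=> tT s0; have Hp := Hphi tT; have Ht := Hphit tT.
have e1 := trace_diff (hphi (j := 1) isT tT) (hphi (j := 2) isT tT)
  (inH_is_wderivn (k := 4) (j := 1) isT Hp).
have e3 := trace_diff (hphi (j := 3) isT tT) (hphi (j := 4) isT tT)
  (inH_is_wderivn (k := 4) (j := 3) isT Hp).
have e1' := trace_diff (hphit (j := 1) isT tT) (hphit (j := 2) isT tT)
  (inH_is_wderivn (k := 2) (j := 1) isT Ht).
rewrite [trace _ 0]phix0// [trace _ 1]phix1// subrr in e1.
rewrite [trace _ 0]phitx0// [trace _ 1]phitx1// subrr in e1'.
have S := ip_eqI (hphitt tT) (hrhs tT) (L2on_cst 1) (strong_equation tT).
have a40 := flux_arith S (ip_rhs tT (L2on_cst 1)) (etrans (ip1 _) (phitt_mean tT))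
  (etrans (ip1 _) (esym e1)) (etrans (ip1 _) (esym e1')) (etrans (ip1 _) (phit_mean tT)) s0.
by apply/esym/eqP; rewrite -subr_eq0; apply/eqP; apply: etrans e3 _; rewrite -ip1.
Qed.

End Strong.

Unset Implicit Arguments.

Theorem proposition2p1 (R : realType) (sigma mu kappa T : R)
    (hsigma : 0 < sigma) (hmu : 0 < mu) (hkappa : 0 <= kappa) (hT : 0 < T)
    (phi0 phib0 : R -> R) (hphi0 : Sbar phi0) (hphib0 : Smean0 phib0)
    (xi0 w0 : R) (f : R -> R) (hf : L2on `]0, T[ f)
    (xi w : R -> R) (phi : R -> R -> R)
    (hweak : weak_solution sigma mu kappa T phi0 phib0 xi0 w0 f xi w phi)
    (hC0 : Ccls 0 T (SbarH 4) phi) (hC1 : Ccls 1 T Sbar phi)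
    (hC2 : Ccls 2 T L2I phi) :
  exists f' : R -> R,
    aeOn `]0, T[ (fun t => f' t = f t) /\
    equations_hold sigma mu kappa T f' xi w phi.
Proof.
have [[xi_ac w_ac _ _] [xi_ode w_ode _] _ [u [ut [Hu _ [u_deriv Hut] phi_u ut_eq]]]] := hweak.
have [phi_C0 _] := hC0; have [_ [phit1 [phi_phit1 [phit1_C0 _]]]] := hC1.
have [phi_L2 [phit [phi_phit [phit_L2 [phitt [phit_phitt [phitt_L2 _]]]]]]] := hC2.
have Hphi t : 0 <= t <= T -> inH 4 (phi t) by move=> /phi_C0[[]].
have hphi t : 0 <= t <= T -> L2on `]0, 1[ (phi t) by move=> /phi_L2[].
have hphit t : 0 <= t <= T -> L2on `]0, 1[ (phit t) by move=> /phit_L2[].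
have Sbar_inH (g : R -> R) : Sbar g -> inH 2 g by case.
(* The derivatives of phi taken in the H^2 norm and in the L^2 norm agree as
   classes, so that each inherits the regularity of the other. *)
have phit1E t : 0 <= t <= T -> eqI (phit1 t) (phit t).
  move=> tT; apply: (tderiv_L2_unique hphi hT tT _ (phi_phit t tT)).
  exact: (tderiv_Hnorm_L2 Sbar_inH _ (phi_phit1 t tT)).
have Hphit1 t : 0 <= t <= T -> inH 2 (phit1 t) by move=> /phit1_C0[/Sbar_inH].
have Hphit t : 0 <= t <= T -> inH 2 (phit t).
  by move=> tT; apply: inH_eqI (Hphit1 t tT) (phit1E t tT) (hphit t tT).
have wphit t : 0 <= t <= T -> wderiv (phit t) = wderiv (phit1 t).
  move=> tT; apply/esym/wderiv_eqI; [|exact: hphit|exact: phit1E].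
  exact: inH_L2on (Hphit1 t tT).
have Hnorm_phit s t : 0 <= s <= T -> 0 <= t <= T ->
    Hnorm 2 (phit s - phit t) = Hnorm 2 (phit1 s - phit1 t).
  move=> sT tT; apply/esym/Hnorm_eqI; [exact: inHB (Hphit1 s sT) (Hphit1 t tT)| |].
    exact: inHB (Hphit s sT) (Hphit t tT).
  by apply: aeOnS (aeOnI (phit1E s sT) (phit1E t tT)) => x _ [E1 E2];
    rewrite -[LHS]/(phit1 s x - phit1 t x) E1 E2.
have phit_cont t : 0 <= t <= T ->
    Hnorm 2 (phit s - phit t) @[s --> within `[0, T] (nbhs t)] --> (0 : R).
  move=> tT; have [_] := phit1_C0 t tT; apply: cvg_trans; apply: near_eq_cvg.
  rewrite near_withinE; apply: nearW => s /=.
  by rewrite in_itv/= => sT; rewrite Hnorm_phit.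
have phit_mean t : 0 <= t <= T -> intI (phit t) = 0.
  move=> tT; have [[_ _ _ <-] _] := phit1_C0 t tT; apply: intI_eqI.
  - by apply: L2on_measurable => //; exact: hphit.
  - by apply: L2on_measurable => //; exact: inH_L2on (Hphit1 t tT).
  - by apply: eqI_sym; exact: phit1E.
have phitx b t : (b = 0) \/ (b = 1) -> 0 <= t <= T -> trace (wderiv (phit t)) b = 0.
  by move=> b01 tT; rewrite wphit//; have [[_ ? ? _] _] := phit1_C0 t tT; case: b01 => ->.
have phix b t : (b = 0) \/ (b = 1) -> 0 <= t <= T -> trace (wderiv (phi t)) b = 0.
  by move=> b01 tT; have [[[_ ? ? _] _] _] := phi_C0 t tT; case: b01 => ->.
have hut : aeOn `]0, T[ (fun t => L2on `]0, 1[ (ut t)).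
  by have [[s [_ sae]] _] := Hut; apply: aeOnS sae => t _ [].
have ux t : 0 <= t <= T -> eqI (wderiv (u t)) (phit t).
  by move=> tT; exact: (tderiv_L2_unique hphi hT tT (phi_u t tT) (phi_phit t tT)).
(* The modified force is dictated by the boundary condition at x = 1. *)
pose f' t := - sigma * trace (wderivn 3 (phi t)) 1.
have phi_cont t tT := (phi_C0 t tT).2.
have phix0 t := phix 0 t (or_introl erefl); have phix1 t := phix 1 t (or_intror erefl).
have phitx0 t := phitx 0 t (or_introl erefl).
have phitx1 t := phitx 1 t (or_intror erefl).
have Hu0 t tT := (Hu.1 t tT).1.
have hphitt t tT := (phitt_L2 t tT).1; have phitt_cont t tT := (phitt_L2 t tT).2.
have f'E : aeOn `]0, T[ (fun t => f' t = f t).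
  exact: (boundary_force hT hf Hphi phi_cont phix1 Hphit phit_cont phitx1
    hphitt phitt_cont phit_phitt Hu0 ux u_deriv hut ut_eq).
have w_C1 t : 0 <= t <= T -> is_tderiv T scalars w t (- f' t).
  apply: (@abs_cont_C1 R T w (fun t => - f' t) w_ac) => //.
    have -> : (fun s => - f' s) = (fun s => sigma * trace (wderivn 3 (phi s)) 1).
      by apply/funext => s; rewrite -mulNr opprK.
    exact: withinZ (flux_continuous Hphi phi_cont).
  by apply: aeOnS (aeOnI f'E w_ode) => s _ [->].
exists f'; split => //; exists phit, phitt => t tT; split.
- split; last exact: w_C1.
  by apply: (abs_cont_C1 xi_ac) => //; exact: abs_cont_continuous.
- split; [exact: phi_phit|exact: phit_phitt|].
  exact: (strong_equation hT hf Hphi phi_cont phix1 Hphit phit_cont phitx1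
    hphitt phitt_cont phit_phitt Hu0 ux u_deriv hut ut_eq).
- by split; [exact: phix0|exact: phix1].
- have sigma0 : sigma != 0 by rewrite gt_eqF.
  have fluxE : trace (wderivn 3 (phi t)) 1 = - sigma^-1 * f' t.
    by rewrite /f' mulNr mulNr mulrN opprK mulrA mulVf// mul1r.
  rewrite -fluxE; split => //.
  exact: (flux_balance hT hf Hphi phi_cont phix0 phix1 Hphit phit_cont phitx0 phitx1
    phit_mean hphitt phitt_cont phit_phitt Hu0 ux u_deriv hut ut_eq).
- by split; [have [[[]]] := phi_C0 t tT|exact: phit_mean].
Qed.
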